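(* Let $V=\mathbb{R}^2(x,y)$ with symplectic form $\omega=dx\wedge dy$, and let $G=\mathrm{Sp}(2,\mathbb{R})=\mathrm{SL}(2,\mathbb{R})$ act linearly on $V$ and trivially on the values $u$ of functions $u=u(x,y)$. Put $$I_0=u,\quad I_1=xu_x+yu_y,\quad I_{2a}=x^2u_{xx}+2xyu_{xy}+y^2u_{yy},$$ $$I_{2b}=xu_yu_{xx}-yu_xu_{yy}+(yu_y-xu_x)u_{xy},\quad I_{2c}=u_x^2u_{yy}-2u_xu_yu_{xy}+u_y^2u_{xx},$$ $$\nabla_1=x\mathcal{D}_x+y\mathcal{D}_y,\qquad \nabla_2=u_x\mathcal{D}_y-u_y\mathcal{D}_x,$$ (where $I_1=\nabla_1(I_0)$, $I_{2a}=\nabla_1^2(I_0)-\nabla_1(I_0)$, $I_{2b}=-\nabla_2\nabla_1(I_0)$). Then the algebra of differential invariants of the $G$-action on the space $J^\infty(V)$ of infinite jets of functions on $V$ is given by generators and relations as $$\mathcal{A}=\langle I_0,I_{2c}\,;\,\nabla_1,\nabla_2\ |\ \mathcal{R}_1,\mathcal{R}_2,\mathcal{R}_3\rangle,$$ where the syzygies are $\mathcal{R}_1=\mathcal{R}_2=\mathcal{R}_3=0$ with $$\mathcal{R}_1=\nabla_2(I_0),\qquad \mathcal{R}_2=I_1[\nabla_1,\nabla_2]-I_{2b}\nabla_1-(I_{2a}-I_1)\nabla_2,$$ $$\mathcal{R}_3=I_1\nabla_2(I_{2b})+I_1\nabla_1(I_{2c})-(3I_{2a}-I_1)I_{2c}+3I_{2b}^2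 .$$
   Context: $J^k(V)$ is the space of $k$-jets of functions $u=u(x,y)$, with coordinates $x,y,u$ and the partial derivatives of $u$ up to order $k$; $\mathcal{D}_x,\mathcal{D}_y$ are the total derivatives. $G$ acts on $J^k(V)$ by prolongation. A differential invariant of order $k$ is a function on $J^k(V)$ constant on orbits of the prolonged action; differential invariants are taken to be rational functions of the jet-variables (and may be chosen polynomial in them). $\mathcal{A}$ is the algebra of all differential invariants. An invariant derivation is a combination of total derivatives, with coefficients functions on a finite jet space, commuting with the prolonged action. $\langle I_i;\nabla_j\mid\mathcal{R}_l\rangle$ means: every element of the algebra is a rational expression in finitely many functions $\nabla_JI_i$ ($\nabla_J$ iterated compositions of the $\nabla_j$), and all relations among these (differential syzygies, including commutator relations) are consequences, algebraic and by applying the $\nabla_j$, of the relations $\mathcal{R}_l=0$. *)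

(* Defs.v *)
From HB Require Import structures.
From mathcomp Require Import all_boot all_order all_algebra.
From mathcomp Require Import generic_quotient.
From mathcomp Require Import finmap.
From mathcomp Require Import boolp reals ring.
From mathcomp.multinomials Require Import monalg.
Set Implicit Arguments.
Unset Strict Implicit.
Unset Printing Implicit Defensive.
Import GRing.Theory.
Local Open Scope ring_scope.

(* The polynomial ring over R in the (possibly infinitely many) variables I. *)
Definition mpol (R : idomainType) (I : choiceType) : Type :=
  {malg R[{cmonom I}]}.
HB.instance Definition _ (R : idomainType) (I : choiceType) :=
  GRing.ComAlgebra.on (mpol R I).

(* [mpol R I] is a domain: Kronecker's substitution of 'X^(B ^ rank i) for i   *)
(* is faithful on finitely many monomials when B is large.                    *)
Section PolynomialDomain.
Variables (R : idomainType) (I : choiceType).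
Local Notation mon := {cmonom I}.
Local Notation pol := {malg R[{cmonom I}]}.

Let weight (s : seq I) (B : nat) (x0 : I) (m : mon) : nat :=
  (\sum_(k < size s) m (nth x0 s k) * B ^ k)%N.

Let digits_inj B n (a b : nat -> nat) :
    (forall k, a k < B)%N -> (forall k, b k < B)%N ->
    (\sum_(k < n) a k * B ^ k = \sum_(k < n) b k * B ^ k)%N ->
  forall k, (k < n)%N -> a k = b k.
Proof.
elim: n a b => [//|n IHn] a b ha hb.
have Bgt0 : (0 < B)%N by apply: leq_ltn_trans (ha 0%N).
have split_sum (c : nat -> nat) : (\sum_(k < n.+1) c k * B ^ k =
    (\sum_(k < n) c k.+1 * B ^ k) * B + c 0)%N.
  rewrite big_ord_recl expn0 muln1 addnC; congr (_ + _)%N.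
  by rewrite big_distrl; apply: eq_bigr => i _; rewrite expnSr mulnA.
rewrite !split_sum => eqab.
have eq0 : a 0%N = b 0%N.
  by move/(congr1 (modn^~ B)): (eqab); rewrite !modnMDl !modn_small.
have {}eqab : (\sum_(k < n) a k.+1 * B ^ k = \sum_(k < n) b k.+1 * B ^ k)%N.
  by move/eqP: eqab; rewrite eq0 eqn_add2r eqn_pmul2r // => /eqP.
case=> [|k]; first by rewrite eq0.
rewrite ltnS => ltkn; apply: (IHn (fun k => a k.+1) (fun k => b k.+1)) => //.
Qed.

Let kron (W : mon -> nat) (p : pol) : {poly R} :=
  mmap (@polyC R) (fun m => 'X^(W m)) p.

Let kronM (W : mon -> nat) : (forall m n, W (mmul m n) = W m + W n)%N ->
  {morph kron W : p q / p * q}.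
Proof.
move=> WM p q; rewrite /kron malgME raddf_sum /= [X in _ = X * _]mmapE.
rewrite mulr_suml; apply: eq_bigr => i _.
rewrite raddf_sum /= [X in _ = _ * X]mmapE mulr_sumr; apply: eq_bigr => j _.
by rewrite (mmapU (f := @polyC R)) /= WM exprD polyCM mulrACA.
Qed.

Let kron_neq0 W p : {in msupp p &, injective W} -> p != 0 -> kron W p != 0.
Proof.
move=> injW; rewrite -msupp_eq0 => /fset0Pn[m mp].
apply/eqP => /(congr1 (fun r : {poly R} => r`_(W m))); rewrite coef0 /kron mmapE.
rewrite coef_sum (bigD1_seq m) //= coefCM coefXn eqxx mulr1 big_seq_cond big1.
  by rewrite addr0 => /eqP; rewrite mcoeff_eq0 mp.
move=> k /andP[kp nk]; rewrite coefCM coefXn.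
by rewrite (inj_in_eq injW) // eq_sym (negPf nk) mulr0.
Qed.

Lemma mpol_integral (p q : pol) : p * q = 0 -> (p == 0) || (q == 0).
Proof.
move=> pq0; apply/norP => -[p0 q0].
pose ms : seq mon := msupp p ++ msupp q.
pose s : seq I := undup (flatten [seq enum_fset (finsupp m) | m : mon <- ms]).
pose B := (\max_(m <- ms) \max_(i <- finsupp m) m i).+1.
have sP (m : mon) i : m \in ms -> i \notin s -> m i = 0%N.
  move=> mms; apply: contraNeq => mi0; rewrite mem_undup.
  by apply/flatten_mapP; exists m; rewrite // -cmE_neq0.
have BP (m : mon) i : m \in ms -> (m i < B)%N.
  move=> mms; rewrite ltnS.
  have [mi|] := boolP (i \in finsupp m); last by rewrite -cmE_eq0 => /eqP->.
  apply: leq_trans (leq_bigmax_seq _ mms isT).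
  exact: (@leq_bigmax_seq _ _ _ (fun i => m i)).
have [x0|noI] := pselect (exists i : I, True); last first.
  have mon1 (m : mon) : m = mone.
    by apply/eqP/cmP => i; case: noI; exists i.
  have cst (r : pol) : r = (r@_mone)%:MP.
    by apply/malgP => k; rewrite (mon1 k) mcoeffC eqxx mulr1n.
  move: pq0; rewrite (cst p) => /malgP/(_ mone)/eqP.
  rewrite mcoeffCM mcoeff0 mulf_eq0 => /orP[] /eqP c0.
    by rewrite (cst p) c0 malgC0E eqxx in p0.
  by rewrite (cst q) c0 malgC0E eqxx in q0.
have {x0} [x0 _] := cid x0.
pose W := weight s B x0.
have WM (m n : mon) : W (mmul m n) = (W m + W n)%N.
  rewrite /W /weight -big_split; apply: eq_bigr => i _.
  by rewrite cmM mulnDl.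
have Winj : {in ms &, injective W}.
  move=> m n mms nms eqW; apply/eqP/cmP => i.
  have [si|nsi] := boolP (i \in s); last by rewrite !(sP _ i).
  rewrite -(nth_index x0 si).
  apply: (digits_inj (B := B) (n := size s)
    (a := fun k => m (nth x0 s k)) (b := fun k => n (nth x0 s k))) => //.
  - by move=> k; apply: BP.
  - by move=> k; apply: BP.
  - by rewrite index_mem.
have := kronM WM p q; rewrite pq0 {1}/kron raddf0 => /esym/eqP.
rewrite mulf_eq0 => /orP[] /idPn; case; apply: kron_neq0 => // m n hm hn.
  by apply: Winj; rewrite mem_cat ?hm ?hn.
by apply: Winj; rewrite mem_cat ?hm ?hn orbT.
Qed.

Let munit (p : mpol R I) : bool := `[< exists q, q * p = 1 >].
Let minv (p : mpol R I) : mpol R I :=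
  if pselect (exists q, q * p = 1) is left ex then projT1 (cid ex) else p.

Let mulVp : {in munit, left_inverse 1 minv *%R}.
Proof.
move=> p /asboolP hp; rewrite /minv; case: pselect => // ex.
exact: projT2 (cid ex).
Qed.

Let unitPl (p q : mpol R I) : q * p = 1 -> munit p.
Proof. by move=> qp; apply/asboolP; exists q. Qed.

Let invr_out : {in [predC munit], minv =1 id}.
Proof.
by move=> p /asboolPn hp; rewrite /minv; case: pselect.
Qed.

HB.instance Definition _ :=
  GRing.ComNzRing_hasMulInverse.Build (mpol R I) mulVp unitPl invr_out.
HB.instance Definition _ :=
  GRing.ComUnitRing_isIntegral.Build (mpol R I) mpol_integral.

End PolynomialDomain.
Section PolynomialMaps.
Variables (R : idomainType) (I : choiceType).
Local Notation pol := (mpol R I).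

Definition mconst (c : R) : pol := c%:MP.
Definition mvar (i : I) : pol := << ucm i >>.

(* The ring morphism restricting to c on the constants and mapping i to phi i. *)
Definition msubst (S : comNzRingType) (c : R -> S) (phi : I -> S) (p : pol) : S :=
  mmap c (fun m : {cmonom I} => \prod_(i <- finsupp m) phi i ^+ m i) p.

(* The R-linear derivation mapping the variable i to phi i. *)
Definition mder (phi : I -> pol) (p : pol) : pol :=
  \sum_(m <- msupp p) \sum_(i <- finsupp m)
     << p@_m *+ m i *g divcm m (ucm i) >> * phi i.

End PolynomialMaps.

Section PolynomialMapsTheory.
Variables (R : idomainType) (I : choiceType).
Local Notation mon := {cmonom I}.
Local Notation pol := (mpol R I).
Implicit Types (p q : pol) (m n : mon) (a b c : R).

Let mon_pol c m : pol := << c *g m >>.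
Let monD m : {morph mon_pol^~ m : a b / a + b}.
Proof. by move=> a b; rewrite /mon_pol monalgUD. Qed.
Let mon0 m : mon_pol 0 m = 0.
Proof. by rewrite /mon_pol monalgU0. Qed.
Let monM a b m n : mon_pol a m * mon_pol b n = mon_pol (a * b) (mmul m n).
Proof. by rewrite [LHS]malgM_def fgmulUU. Qed.
Let polE p : p = \sum_(m <- msupp p) mon_pol p@_m m.
Proof. exact: monalgE. Qed.

Section Derivation.
Variable phi : I -> pol.

Let term m c : pol :=
  \sum_(i <- finsupp m) mon_pol (c *+ m i) (divcm m (ucm i)) * phi i.

Let termE (d : {fset I}) m c : (finsupp m `<=` d)%fset ->
  term m c = \sum_(i <- d) mon_pol (c *+ m i) (divcm m (ucm i)) * phi i.
Proof.
move=> le; rewrite [LHS](big_fset_incl _ le) // => i _.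
by rewrite -cmE_eq0 => /eqP->; rewrite mulr0n mon0 mul0r.
Qed.

Let termD m : {morph term m : a b / a + b}.
Proof.
move=> a b; rewrite /term -big_split /=; apply: eq_bigr => i _.
by rewrite mulrnDl monD mulrDl.
Qed.

Let mderE (d : {fset mon}) p : (msupp p `<=` d)%fset ->
  mder phi p = \sum_(m <- d) term m p@_m.
Proof.
move=> le; rewrite [LHS](big_fset_incl _ le) // => m _ /mcoeff_outdom->.
by rewrite big1 // => i _; rewrite mul0rn -/(mon_pol _ _) mon0 mul0r.
Qed.

Lemma mderD : {morph mder phi : p q / p + q}.
Proof.
move=> p q; pose d := (msupp p `|` msupp q `|` msupp (p + q : {malg R[mon]}))%fset.
have sub (e : {fset mon}) :
    e \in [:: msupp p; msupp q; msupp (p + q : {malg R[mon]})] -> (e `<=` d)%fset.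
  by rewrite !inE => /or3P[] /eqP->; apply/fsubsetP => z;
    rewrite !inE => ->; rewrite ?orbT.
rewrite !(mderE (sub _ _)) ?inE ?eqxx ?orbT // -big_split; apply: eq_bigr => m _.
by rewrite mcoeffD termD.
Qed.

Let mder_mon c m : mder phi (mon_pol c m) = term m c.
Proof. by rewrite (mderE msuppU_le) big_seq_fset1 mcoeffUU. Qed.

Lemma mder0 : mder phi 0 = 0.
Proof. by rewrite (@mderE fset0) ?msupp0 ?big_seq_fset0. Qed.

Lemma mder_const c : mder phi (mconst I c) = 0.
Proof. by rewrite mder_mon /term mdom1 big_seq_fset0. Qed.

Lemma mder_var i : mder phi (mvar R i) = phi i.
Proof.
rewrite mder_mon /term mdomU big_seq_fset1 cmUU mulr1n.
suff -> : divcm (ucm i) (ucm i) = mone by rewrite [X in X * _](_ : _ = 1) ?mul1r.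
by apply/eqP/cmP => j; rewrite divcmE subnn cm1.
Qed.

Let mder_sum (J : Type) (r : seq J) (F : J -> pol) :
  mder phi (\sum_(j <- r) F j) = \sum_(j <- r) mder phi (F j).
Proof. exact: (big_morph _ mderD mder0). Qed.

Let mderM_mon a b m n : mder phi (mon_pol a m * mon_pol b n) =
  mder phi (mon_pol a m) * mon_pol b n + mon_pol a m * mder phi (mon_pol b n).
Proof.
clearbody term mon_pol; rewrite monM !mder_mon; set d := (finsupp m `|` finsupp n)%fset.
rewrite (termE (d := d)) ?mdomD ?fsubset_refl //.
rewrite (termE (d := d)) ?fsubsetUl //.
rewrite (termE (d := d)) ?fsubsetUr //.
rewrite mulr_suml mulr_sumr -big_split; apply: eq_bigr => i _ /=.
rewrite mulrAC mulrA !monM -mulrDl; congr (_ * _).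
rewrite cmM mulrnDr monD; congr (_ + _).
  have [->|mi] := eqVneq (m i) 0%N; first by rewrite !mulr0n mul0r !mon0.
  rewrite mulrnAl; congr mon_pol; apply/eqP/cmP => j.
  rewrite divcmE !cmM divcmE cmU; case: eqVneq => [<-|]; last by rewrite !subn0.
  by rewrite addnC -addnBA ?lt0n // addnC.
have [->|mi] := eqVneq (n i) 0%N; first by rewrite !mulr0n mulr0 !mon0.
rewrite mulrnAr; congr mon_pol; apply/eqP/cmP => j.
rewrite divcmE !cmM divcmE cmU; case: eqVneq => [<-|]; last by rewrite !subn0.
by rewrite -addnBA ?lt0n.
Qed.

Lemma mderM p q : mder phi (p * q) = mder phi p * q + p * mder phi q.
Proof.
rewrite (polE p) (polE q); clearbody term mon_pol.
rewrite mulr_suml !mder_sum !mulr_suml -big_split.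
apply: eq_bigr => m _; rewrite !mulr_sumr mder_sum -big_split.
by apply: eq_bigr => n _; exact: mderM_mon.
Qed.
End Derivation.

Section Substitution.
Variables (S : comNzRingType) (c : {rmorphism R -> S}) (phi : I -> S).
Let ev m : S := \prod_(i <- finsupp m) phi i ^+ m i.
Let evE (d : {fset I}) m : (finsupp m `<=` d)%fset ->
  ev m = \prod_(i <- d) phi i ^+ m i.
Proof.
move=> le; rewrite [LHS](big_fset_incl _ le) // => i _.
by rewrite -cmE_eq0 => /eqP->; rewrite expr0.
Qed.
Let ev_mmorph : mmorphism ev.
Proof.
split=> [m n|]; last by rewrite /ev mdom1 big_seq_fset0.
rewrite (evE (d := (finsupp m `|` finsupp n)%fset)) ?mdomD ?fsubset_refl //.
rewrite (evE (fsubsetUl _ (finsupp n))) (evE (fsubsetUr (finsupp m) _)).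
by rewrite -big_split; apply: eq_bigr => i _; rewrite cmM exprD.
Qed.
HB.instance Definition _ := isMultiplicative.Build _ _ ev ev_mmorph.

Lemma msubst_is_zmod : zmod_morphism (msubst c phi : pol -> S).
Proof. exact: (mmap_is_additive (f := c) (h := ev)). Qed.
Lemma msubst_is_monoid : monoid_morphism (msubst c phi : pol -> S).
Proof.
have [M U] := mmap_is_multiplicative (f := c) (h := ev).
by split; [exact: U | exact: M].
Qed.
Lemma msubst_const a : msubst c phi (mconst I a) = c a.
Proof. exact: (mmapC (f := c) (h := ev)). Qed.
Lemma msubst_var i : msubst c phi (mvar R i) = phi i.
Proof. rewrite [LHS](mmapU (f := c)) mdomU big_seq_fset1 cmUU [X in X * _](rmorph1 c).
exact: mul1r. Qed.
End Substitution.
End PolynomialMapsTheory.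

Section FractionMaps.
Variable S : idomainType.
Local Notation "a %:F" := (@tofrac S a).

(* For phi an injective ring endomorphism of S and d a derivation of S, the   *)
(* values below do not depend on the representative n / d of q.               *)
Definition frac_map (phi : S -> S) (q : {fraction S}) : {fraction S} :=
  let r := frac (repr q) in (phi r.1)%:F / (phi r.2)%:F.

Definition frac_der (d : S -> S) (q : {fraction S}) : {fraction S} :=
  let r := frac (repr q) in
  (d r.1 * r.2 - r.1 * d r.2)%:F / (r.2 ^+ 2)%:F.

End FractionMaps.

Section FractionMapsTheory.
Variable S : idomainType.
Local Notation "a %:F" := (@tofrac S a).

Lemma frac_repr (q : {fraction S}) :
  let r := frac (repr q) in q = r.1%:F / r.2%:F.
Proof.
move=> r; have r2 : r.2%:F != 0 by rewrite tofrac_eq0 denom_ratioP.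
apply: (mulIf r2); rewrite mulfVK // -[q in LHS]reprK -/r; unlock tofrac.
rewrite -[LHS]FracField.pi_mul; apply/eqmodP; rewrite /= FracField.equivfE.
rewrite /FracField.mulf !numden_Ratio ?mulf_neq0 ?oner_neq0 ?denom_ratioP //.
by rewrite !mulr1 mulrC.
Qed.

Let cross (a b : S) : b != 0 ->
  let r := frac (repr (a%:F / b%:F)) in r.2 != 0 /\ a * r.2 = r.1 * b.
Proof.
move=> b0 r; have r2 : r.2 != 0 by apply: denom_ratioP.
split=> //; have /eqP := frac_repr (a%:F / b%:F); rewrite -/r.
by rewrite eqr_div ?tofrac_eq0 // -!tofracM tofrac_eq => /eqP.
Qed.

Lemma frac_derE (d : S -> S) a b :
    (forall p q, d (p * q) = d p * q + p * d q) -> b != 0 ->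
  frac_der d (a%:F / b%:F) = (d a * b - a * d b)%:F / (b ^+ 2)%:F.
Proof.
move=> dM b0; rewrite /frac_der; have [] := cross a b0; set r := frac _.
move=> r2 e; apply/eqP.
rewrite eqr_div ?tofrac_eq0 ?expf_neq0 // -!tofracM tofrac_eq; apply/eqP.
have := congr1 d e; rewrite !dM => e'.
move: (r.1) (r.2) (d a) (d b) (d r.1) (d r.2) e e' => n m A B N M e e'.
rewrite (_ : _ * _ = (N * b + n * B) * (m * b) - (n * b) * (m * B + M * b));
  last by ring.
by rewrite -e -e'; ring.
Qed.

Lemma frac_mapE (phi : {rmorphism S -> S}) a b : injective phi -> b != 0 ->
  frac_map phi (a%:F / b%:F) = (phi a)%:F / (phi b)%:F.
Proof.
move=> inj b0; rewrite /frac_map; have [] := cross a b0; set r := frac _.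
move=> r2 e; apply/eqP.
rewrite eqr_div ?tofrac_eq0 ?(raddf_eq0 _ inj) // -!tofracM tofrac_eq.
by rewrite -!rmorphM e.
Qed.
End FractionMapsTheory.

(* Coordinates on the jet spaces: [JU i j] is the derivative of u taken i     *)
(* times in x and j times in y.                                               *)
Variant jetvar := JX | JY | JU of nat & nat.

Definition jetvar_code (v : jetvar) : bool + nat * nat :=
  match v with JX => inl false | JY => inl true | JU i j => inr (i, j) end.
Definition jetvar_decode (c : bool + nat * nat) : jetvar :=
  match c with inl b => if b then JY else JX | inr (i, j) => JU i j end.
Lemma jetvar_codeK : cancel jetvar_code jetvar_decode.
Proof. by case. Qed.
HB.instance Definition _ := Choice.copy jetvar (can_type jetvar_codeK).

Section Jets.
Variable R : realType.

(* A polynomial or rational function on J^oo(V) involves finitely many jet    *)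
(* variables, hence is a function on some J^k(V).                             *)
Definition jpoly := mpol R jetvar.
Definition jrat := {fraction jpoly}.
Local Notation "a %:F" := (@tofrac jpoly a).

Definition jx : jpoly := mvar R JX.
Definition jy : jpoly := mvar R JY.
Definition ju (i j : nat) : jpoly := mvar R (JU i j).

Definition Dx_poly : jpoly -> jpoly := mder (fun v =>
  match v with JX => 1 | JY => 0 | JU i j => ju i.+1 j end).
Definition Dy_poly : jpoly -> jpoly := mder (fun v =>
  match v with JX => 0 | JY => 1 | JU i j => ju i j.+1 end).
Definition Dx : jrat -> jrat := frac_der Dx_poly.
Definition Dy : jrat -> jrat := frac_der Dy_poly.

(* [prolong_poly g F] is the pullback F \o g of F by the prolonged action     *)
(*   g . j_a(f) = j_(g a)(f \o g^-1).                                         *)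
(* With h = g^-1 and v = f \o h, the chain rule gives                         *)
(*   v_X = h_00 f_x + h_10 f_y  and  v_Y = h_01 f_x + h_11 f_y                *)
(* (at corresponding points), so the derivatives of v are obtained from f by  *)
(* iterating the operators DX and DY below.                                   *)
Definition prolong_poly (g : 'M[R]_2) : jpoly -> jpoly :=
  let h := invmx g in
  let DX p := h 0 0 *: Dx_poly p + h 1 0 *: Dy_poly p in
  let DY p := h 0 1 *: Dx_poly p + h 1 1 *: Dy_poly p in
  msubst (@mconst R jetvar) (fun v => match v with
    | JX => g 0 0 *: jx + g 0 1 *: jy
    | JY => g 1 0 *: jx + g 1 1 *: jy
    | JU i j => iter i DX (iter j DY (ju 0 0))
    end).
Definition prolong (g : 'M[R]_2) : jrat -> jrat := frac_map (prolong_poly g).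

Definition diff_invariant (q : jrat) : Prop :=
  forall g : 'M[R]_2, \det g = 1 -> prolong g q = q.

Definition invariant_derivation (nab : jrat -> jrat) : Prop :=
  (exists a b : jrat, forall q, nab q = a * Dx q + b * Dy q) /\
  (forall g : 'M[R]_2, \det g = 1 ->
     forall q, nab (prolong g q) = prolong g (nab q)).

Local Notation x := (jx%:F).
Local Notation y := (jy%:F).
Local Notation u := ((ju 0 0)%:F).
Local Notation u_x := ((ju 1 0)%:F).
Local Notation u_y := ((ju 0 1)%:F).
Local Notation u_xx := ((ju 2 0)%:F).
Local Notation u_xy := ((ju 1 1)%:F).
Local Notation u_yy := ((ju 0 2)%:F).

Definition I0 : jrat := u.
Definition I1 : jrat := x * u_x + y * u_y.
Definition I2a : jrat := x ^+ 2 * u_xx + 2 * x * y * u_xy + y ^+ 2 * u_yy.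
Definition I2b : jrat :=
  x * u_y * u_xx - y * u_x * u_yy + (y * u_y - x * u_x) * u_xy.
Definition I2c : jrat :=
  u_x ^+ 2 * u_yy - 2 * u_x * u_y * u_xy + u_y ^+ 2 * u_xx.

Definition nabla1 (q : jrat) : jrat := x * Dx q + y * Dy q.
Definition nabla2 (q : jrat) : jrat := u_x * Dy q - u_y * Dx q.

End Jets.

Arguments I0 {R}.
Arguments I1 {R}.
Arguments I2a {R}.
Arguments I2b {R}.
Arguments I2c {R}.

Variant nabla_index := N1 | N2.
Variant generator := G0 | G2c.

Definition is_N2 j := if j is N2 then true else false.
Lemma is_N2K : cancel is_N2 (fun b => if b then N2 else N1).
Proof. by case. Qed.
HB.instance Definition _ := Choice.copy nabla_index (can_type is_N2K).

Definition is_G2c i := if i is G2c then true else false.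
Lemma is_G2cK : cancel is_G2c (fun b => if b then G2c else G0).
Proof. by case. Qed.
HB.instance Definition _ := Choice.copy generator (can_type is_G2cK).

Section Relations.
Variable R : realType.

Definition nabla (j : nabla_index) : jrat R -> jrat R :=
  match j with N1 => @nabla1 R | N2 => @nabla2 R end.

Definition gen (i : generator) : jrat R :=
  match i with G0 => I0 | G2c => I2c end.

(* [nabla_iter J i] is the iterated derivative \nabla_J I_i, where            *)
(* [:: j1; ...; jr] stands for the composition \nabla_j1 \o ... \o \nabla_jr. *)
Definition nabla_iter (J : seq nabla_index) (i : generator) : jrat R :=
  foldr nabla (gen i) J.

(* Formal polynomial expressions in the symbols (J, i) standing for           *)
(* \nabla_J I_i, all words J being allowed.                                   *)
Definition formal := mpol R (seq nabla_index * generator)%type.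

Definition symb (J : seq nabla_index) (i : generator) : formal := mvar R (J, i).

Definition eval : formal -> jrat R :=
  msubst (fun c => tofrac (mconst jetvar c)) (fun w => nabla_iter w.1 w.2).

Definition fnabla (j : nabla_index) : formal -> formal :=
  mder (fun w => symb (j :: w.1) w.2).

Local Notation D1 := (fnabla N1).
Local Notation D2 := (fnabla N2).

Definition fI0 : formal := symb [::] G0.
Definition fI2c : formal := symb [::] G2c.
Definition fI1 : formal := D1 fI0.
Definition fI2a : formal := D1 (D1 fI0) - D1 fI0.
Definition fI2b : formal := - D2 (D1 fI0).

Definition R1 : formal := D2 fI0.
(* The second syzygy is a relation between derivations, so it contributes one *)
(* relation for each expression p it is applied to.                           *)
Definition R2 (p : formal) : formal :=
  fI1 * (D1 (D2 p) - D2 (D1 p)) - fI2b * D1 p - (fI2a - fI1) * D2 p.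
Definition R3 : formal :=
  fI1 * D2 fI2b + fI1 * D1 fI2c - (3 * fI2a - fI1) * fI2c + 3 * fI2b ^+ 2.

(* The consequences of the syzygies, algebraically and by applying the        *)
(* \nabla_j. Since rational expressions are allowed, one may divide by any    *)
(* expression which is not identically zero as a function on jets.            *)
Inductive consequence : formal -> Prop :=
| cons_R1 : consequence R1
| cons_R2 p : consequence (R2 p)
| cons_R3 : consequence R3
| cons_0 : consequence 0
| cons_add p q : consequence p -> consequence q -> consequence (p + q)
| cons_mul p q : consequence q -> consequence (p * q)
| cons_nabla j p : consequence p -> consequence (fnabla j p)
| cons_div p q : eval p <> 0 -> consequence (p * q) -> consequence q.

End Relations.

(* Main.v *)
(* Let A = (x, y), B = (- u_y, u_x). Contracting the k-th symmetric            *)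
(* differential of u with i copies of A and j copies of B gives invariants     *)
(* T_ij (i + j = k), and A, B / I1 are the columns of the inverse of a moving  *)
(* frame. The coordinates of the jet moved by the frame are rational in the    *)
(* T_ij, and the T_ij are obtained from I0, I2c by \nabla_1, \nabla_2 because  *)
(* \nabla_j A and \nabla_j B are combinations of A and B with coefficients in  *)
(* I1, I2a, I2b, I2c. The values of an invariant at two points of the orbit of *)
(* SL(2) over the function field agree by density of the real points of        *)
(* SL(2), so it equals its value at the moved jet.                             *)
(* For the syzygies, R1, R2, R3 allow one, after multiplication by a power of  *)
(* I1, to rewrite every expression as a polynomial in I0,                      *)
(* \nabla_2^j \nabla_1^i I1 and \nabla_2^j I2c. These are algebraically        *)
(* independent: their principal symbols are, up to powers of I1, distinct      *)
(* monomials in the coordinates dual to A and B, so that their Jacobian matrix *)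
(* is triangular.                                                              *)
From HB Require Import structures.
Require Import Defs.
From mathcomp Require Import all_boot all_order all_algebra.
From mathcomp Require Import reals finmap ring.
From mathcomp Require Import boolp.
From mathcomp.multinomials Require Import monalg.
Set Implicit Arguments.
Unset Strict Implicit.
Unset Printing Implicit Defensive.
Import GRing.Theory.
Local Open Scope ring_scope.

(** * Polynomials and derivations *)

(** Put A = (x, y), B = (- u_y, u_x); then det(A, B) = I1, and \nabla_1, \nabla_2 are the total
    derivatives along A and B.

    Generators. The derivations \nabla_1, \nabla_2 commute with the action ([prolong_N1],
    [prolong_N2]) and I0, I2c are fixed, so everything generated is invariant
    ([generated_invariant]). Conversely, let n / d be invariant. The identity n(g) d = n d(g) is
    polynomial in the entries of g, so by [sl2_density] it passes from real matrices to SL(2, K),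
    with K the field of rational functions on jets. For g equal to the frame (A, B / I1), times a
    real matrix that keeps d(g) nonzero, it expresses n / d through the coordinates of the
    normalised jet ([invariant_generated]). These are built from the contractions T_ij, and those of
    order n + 1 come from differentiating those of order n: the error terms contain only \nabla_j A
    and \nabla_j B, which are known combinations of A and B ([frame_der_coord], [FF_frame_coord]).

    Relations. That R1, R2, R3 hold is a direct computation ([nabla_commutator], [nabla_syzygy]).
    Modulo their consequences, a power of I1 times any expression is a polynomial in the normal
    generators ([reducible_D1], [reducible_D2]). A normal generator of order k has principal symbol
    I1^k X^j, and no two share both k and j, so a triangular Jacobian makes them algebraically
    independent ([normal_independent]). An expression that evaluates to 0 therefore has normal form
    0, and dividing by the power of I1 makes it a consequence ([reducible_ev_eq0]). *)

Section PolynomialInduction.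
Variables (R : idomainType) (I : choiceType).
Implicit Types (p : mpol R I) (P : mpol R I -> Prop).

(** The assumption on variables is limited to those occurring in [p], as [der_msubst] requires.
    Monomials are treated by induction on the degree. *)
Lemma mpol_ind_supp P p :
  (forall c, P (mconst I c)) ->
  (forall (m : {cmonom I}) i, m \in msupp p -> i \in finsupp m -> P (mvar R i)) ->
  (forall q r, P q -> P r -> P (q + r)) ->
  (forall q r, P q -> P r -> P (q * r)) -> P p.
Proof.
move=> Pc Pv PD PM.
have Pmon : forall n (m : {cmonom I}) c, mdeg m = n ->
    (forall i, i \in finsupp m -> P (mvar R i)) ->
    P (<< c *g m >> : {malg R[{cmonom I}]}).
  elim=> [|n IHn] m c mn Pm.
    by rewrite (mdeg_eq0I mn); apply: Pc.
  have [m1|[i mi]] : m = mone \/ exists i, i \in finsupp m.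
    have [m0|[i mi]] := fset_0Vmem (finsupp m); last by right; exists i.
    by left; apply/mdeg_eq0I; rewrite mdegE m0 big_seq_fset0.
    by rewrite m1 mdeg1 in mn.
  have mE : m = mmul (divcm m (ucm i)) (ucm i).
    apply/eqP/cmP => j; rewrite cmM divcmE cmU.
    by case: eqVneq => [<-|_]; rewrite ?subn0 ?addn0 // subnK // lt0n cmE_neq0.
  have -> : (<< c *g m >> : mpol R I) =
      (<< c *g divcm m (ucm i) >> : mpol R I) * mvar R i.
    by rewrite [RHS]malgM_def fgmulUU mulr1 -mE.
  apply: PM; last exact: Pm.
  apply: IHn => [|j]; first by move: mn; rewrite {1}mE mdegM mdegU addn1 => -[].
  by move=> mj; apply: Pm; rewrite mE mdomD inE mj.
rewrite (monalgE (p : {malg R[{cmonom I}]})) big_seq.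
apply: (big_ind P) => [||m mp].
- by have := Pc 0; rewrite /mconst malgC0E.
- exact: PD.
by apply: (Pmon (mdeg m)) => // i mi; apply: Pv mp mi.
Qed.

Lemma mpol_ind P :
  (forall c, P (mconst I c)) -> (forall i, P (mvar R i)) ->
  (forall q r, P q -> P r -> P (q + r)) ->
  (forall q r, P q -> P r -> P (q * r)) -> forall p, P p.
Proof. by move=> Pc Pv PD PM p; apply: mpol_ind_supp => // m i _ _; apply: Pv. Qed.

Lemma mconst_is_zmod_morphism : zmod_morphism (@mconst R I).
Proof. exact: raddfB. Qed.
Lemma mconst_is_monoid_morphism : monoid_morphism (@mconst R I).
Proof. by split=> [|c d]; [exact: mpolyC1E|exact: mpolyCM]. Qed.

HB.instance Definition _ := GRing.isZmodMorphism.Build R (mpol R I)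
  (@mconst R I) mconst_is_zmod_morphism.
HB.instance Definition _ := GRing.isMonoidMorphism.Build R (mpol R I)
  (@mconst R I) mconst_is_monoid_morphism.

Lemma mconst_inj : injective (@mconst R I).
Proof. by move=> c d /eqP; rewrite malgC_eq => /eqP. Qed.

Lemma mpolZE c p : c *: p = mconst I c * p.
Proof. by rewrite [RHS]mul_malgC. Qed.

HB.instance Definition _ (S : comNzRingType) (c : {rmorphism R -> S}) phi :=
  GRing.isZmodMorphism.Build (mpol R I) S (msubst c phi) (msubst_is_zmod c phi).
HB.instance Definition _ (S : comNzRingType) (c : {rmorphism R -> S}) phi :=
  GRing.isMonoidMorphism.Build (mpol R I) S (msubst c phi)
    (msubst_is_monoid c phi).

End PolynomialInduction.

Section Derivations.

Definition derivation (S : pzRingType) (d : S -> S) : Prop :=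
  (forall p q, d (p + q) = d p + d q) /\
  (forall p q, d (p * q) = d p * q + p * d q).

Section Ring.
Variables (S : pzRingType) (d : S -> S).
Hypothesis der : derivation d.

Lemma derD p q : d (p + q) = d p + d q. Proof. by case: der. Qed.
Lemma derM p q : d (p * q) = d p * q + p * d q. Proof. by case: der. Qed.
Lemma der0 : d 0 = 0.
Proof. by apply: (addrI (d 0)); rewrite -derD !addr0. Qed.
Lemma derN p : d (- p) = - d p.
Proof. by apply: (addrI (d p)); rewrite -derD !subrr der0. Qed.
Lemma derB p q : d (p - q) = d p - d q.
Proof. by rewrite derD derN. Qed.
Lemma der1 : d 1 = 0.
Proof. by apply: (addrI (d 1)); rewrite addr0 -[in RHS](mulr1 1) derM mulr1 mul1r. Qed.
Lemma derMn p n : d (p *+ n) = d p *+ n.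
Proof. by elim: n => [|n IHn]; rewrite ?mulr0n ?der0 // !mulrS derD IHn. Qed.
Lemma der_nat n : d n%:R = 0.
Proof. by rewrite derMn der1 mul0rn. Qed.
End Ring.

Lemma der_comb (S : comPzRingType) (a b : S) (d e : S -> S) :
  derivation d -> derivation e -> derivation (fun p => a * d p + b * e p).
Proof.
by move=> dd de; split=> p q; rewrite ?(derD dd, derD de, derM dd, derM de); ring.
Qed.

Lemma der_combB (S : comPzRingType) (a b : S) (d e : S -> S) :
  derivation d -> derivation e -> derivation (fun p => a * d p - b * e p).
Proof.
by move=> dd de; split=> p q; rewrite ?(derD dd, derD de, derM dd, derM de); ring.
Qed.

Lemma der_comm (S : comPzRingType) (d e : S -> S) :
  derivation d -> derivation e -> derivation (fun p => d (e p) - e (d p)).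
Proof.
move=> dd de; split=> p q; rewrite !(derD dd, derD de, derM dd, derM de); ring.
Qed.

Lemma der_sub (S : comPzRingType) (d e : S -> S) :
  derivation d -> derivation e -> derivation (fun p => d p - e p).
Proof.
by move=> dd de; split=> p q; rewrite ?(derD dd, derD de, derM dd, derM de); ring.
Qed.

Lemma derXn (S : comPzRingType) (d : S -> S) p n :
  derivation d -> d (p ^+ n) = p ^+ n.-1 * d p *+ n.
Proof.
move=> dd; elim: n => [|[|n] IHn]; first by rewrite expr0 (der1 dd) mulr0n.
  by rewrite expr1 mul1r.
by rewrite exprS (derM dd) IHn /= [in RHS]mulrS mulrnAr mulrA -exprS [d p * _]mulrC.
Qed.

Lemma mder_derivation (R : idomainType) (I : choiceType) (phi : I -> mpol R I) :
  derivation (mder phi).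
Proof. by split=> p q; rewrite ?mderD ?mderM. Qed.

End Derivations.

(** * Derivations and endomorphisms of fraction fields *)

Section FractionDerivation.
Variables (S : idomainType) (d : S -> S).
Hypothesis dd : derivation d.
Local Notation "a %:F" := (@tofrac S a).

Lemma frac_ind (P : {fraction S} -> Prop) :
  (forall a b, b != 0 -> P (a%:F / b%:F)) -> forall q, P q.
Proof. by move=> PF q; rewrite (frac_repr q); apply: PF; apply: denom_ratioP. Qed.

Lemma frac_der_tofrac a : frac_der d a%:F = (d a)%:F.
Proof.
rewrite -[a%:F]divr1 -tofrac1 (frac_derE _ (derM dd)) ?oner_neq0 //.
by rewrite (der1 dd) mulr0 subr0 mulr1 expr1n tofrac1 divr1.
Qed.

Lemma frac_der_derivation : derivation (frac_der d).
Proof.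
have dM := derM dd.
split; elim/frac_ind=> a b b0; elim/frac_ind=> c e e0.
  rewrite !frac_derE // addf_div ?tofrac_eq0 // -!tofracM -tofracD.
  rewrite frac_derE ?mulf_neq0 //.
  rewrite addf_div ?tofrac_eq0 ?expf_neq0 // -!tofracM -tofracD.
  apply/eqP; rewrite eqr_div ?tofrac_eq0 ?mulf_neq0 ?expf_neq0 //.
  by rewrite -!tofracM tofrac_eq; apply/eqP; rewrite (derD dd) !dM; ring.
rewrite !frac_derE // mulf_div -!tofracM frac_derE ?mulf_neq0 //.
rewrite !mulf_div -!tofracM addf_div ?tofrac_eq0 ?mulf_neq0 ?expf_neq0 //.
rewrite -!tofracM -tofracD.
apply/eqP; rewrite eqr_div ?tofrac_eq0 ?mulf_neq0 ?expf_neq0 //.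
by rewrite -!tofracM tofrac_eq; apply/eqP; rewrite !dM; ring.
Qed.

End FractionDerivation.

Section FractionMorphism.
Variables (S : idomainType) (phi : {rmorphism S -> S}).
Hypothesis phiI : injective phi.
Local Notation "a %:F" := (@tofrac S a).

Lemma frac_map_tofrac a : frac_map phi a%:F = (phi a)%:F.
Proof.
by rewrite -[a%:F]divr1 -tofrac1 frac_mapE ?oner_neq0 // rmorph1 tofrac1 divr1.
Qed.

Lemma frac_map_is_zmod_morphism : zmod_morphism (frac_map phi).
Proof.
elim/frac_ind=> a b b0; elim/frac_ind=> c e e0.
rewrite -mulNr -tofracN addf_div ?tofrac_eq0 // -!tofracM -tofracD.
rewrite !frac_mapE ?mulf_neq0 // -mulNr -tofracN.
rewrite addf_div ?tofrac_eq0 ?(raddf_eq0 _ phiI) // -!tofracM -tofracD.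
by rewrite rmorphD !rmorphM rmorphN.
Qed.

Lemma frac_map_is_monoid_morphism : monoid_morphism (frac_map phi).
Proof.
split; first by rewrite -tofrac1 frac_map_tofrac rmorph1.
elim/frac_ind=> a b b0; elim/frac_ind=> c e e0.
by rewrite mulf_div -!tofracM !frac_mapE ?mulf_neq0 // mulf_div -!tofracM !rmorphM.
Qed.

End FractionMorphism.

(** * Partial derivatives and the Jacobian criterion *)

Section Jacobian.

Definition mpartial (R : idomainType) (I : choiceType) (v : I) :
  mpol R I -> mpol R I := mder (fun w => (w == v)%:R).

Lemma sum_mul_delta (S : pzRingType) (I : eqType) (r : seq I) (F : I -> S) v :
  uniq r -> \sum_(i <- r) F i * (i == v)%:R = if v \in r then F v else 0.
Proof.
move=> ur; have [rv|nrv] := boolP (v \in r).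
  rewrite (bigD1_seq v) //= eqxx mulr1 big1 ?addr0 // => i /negPf->.
  by rewrite mulr0.
rewrite big1_seq // => i /andP[_ ri]; case: eqP => [iv|_]; last by rewrite mulr0.
by rewrite -iv ri in nrv.
Qed.

Lemma mcoeff_mpartial (R : idomainType) (I : choiceType) (v : I)
    (p : mpol R I) (k : {cmonom I}) :
  (mpartial v p : {malg R[{cmonom I}]})@_k = p@_(mmul k (ucm v)) *+ (k v).+1.
Proof.
pose t (m : {cmonom I}) : {malg R[{cmonom I}]} :=
  << p@_m *+ m v *g divcm m (ucm v) >>.
have -> : mpartial v p = \sum_(m <- msupp p) t m.
  apply: eq_bigr => m _; rewrite [LHS]sum_mul_delta ?fset_uniq //.
  case: ifPn => //; rewrite -cmE_eq0 /t => /eqP->.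
  by rewrite mulr0n monalgU0.
rewrite raddf_sum /=; pose kv : {cmonom I} := mmul k (ucm v).
have kvv : kv v = (k v).+1 by rewrite cmM cmUU addn1.
have kvE : divcm kv (ucm v) = k.
  by apply/eqP/cmP => j; rewrite divcmE cmM addnK.
have tkv m : m \in msupp p -> m != kv -> (t m)@_k = 0.
  move=> mp mk; rewrite /t mcoeffU; case: eqP => [dm|]; last by rewrite mulr0n.
  have [->|mv0] := eqVneq (m v) 0%N; first by rewrite mulr0n mul0rn.
  case/eqP: mk; rewrite /kv -dm; apply/eqP/cmP => j.
  rewrite cmM divcmE cmU; case: eqVneq => [<-|_]; last by rewrite subn0 addn0.
  by rewrite subnK // lt0n.
have [kp|nkp] := boolP (kv \in msupp p).
  rewrite (bigD1_seq kv) ?fset_uniq //= [X in X + _](_ : _ = p@_kv *+ kv v).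
    by rewrite kvv big_seq_cond big1 ?addr0 // => m /andP[mp mk]; apply: tkv.
  by rewrite /t kvE mcoeffUU.
rewrite (mcoeff_outdom nkp) mul0rn big1_seq // => m /andP[_ mp].
by apply: tkv => //; apply: contraNneq nkp => <-.
Qed.

Lemma mpartial_derivation (R : idomainType) (I : choiceType) (v : I) :
  derivation (@mpartial R I v).
Proof. exact: mder_derivation. Qed.

Lemma mpartial_const (R : idomainType) (I : choiceType) (v : I) (a : R) :
  mpartial v (mconst I a) = 0.
Proof. exact: mder_const. Qed.

Lemma mpartial_var (R : idomainType) (I : choiceType) (v w : I) :
  mpartial v (mvar R w) = (w == v)%:R.
Proof. exact: mder_var. Qed.

#[local] Opaque mder msubst mconst mvar mpartial.

(** The chain rule, with one term left because [d] kills the images of all other variables of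
    [p]. *)
Lemma der_msubst (R : idomainType) (I : choiceType) (S : comNzRingType)
    (c : {rmorphism R -> S}) (phi : I -> S) (d : S -> S) v p :
  derivation d -> (forall a, d (c a) = 0) ->
  (forall (m : {cmonom I}) w,
     m \in msupp p -> w \in finsupp m -> w != v -> d (phi w) = 0) ->
  d (msubst c phi p) = msubst c phi (mpartial v p) * d (phi v).
Proof.
move=> dd dc dphi.
apply: (@mpol_ind_supp _ _
  (fun q => d (msubst c phi q) = msubst c phi (mpartial v q) * d (phi v)) p).
- by move=> a; rewrite msubst_const dc mpartial_const rmorph0 mul0r.
- move=> m w mp mw; rewrite msubst_var mpartial_var.
  case: eqVneq => [->|wv]; first by rewrite rmorph1 mul1r.
  by rewrite rmorph0 mul0r (dphi m).
- move=> q r qE rE; rewrite (derD (mpartial_derivation R v)) !rmorphD.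
  by rewrite (derD dd) qE rE mulrDl.
move=> q r qE rE; rewrite (derM (mpartial_derivation R v)).
rewrite (rmorphD (msubst c phi)).
rewrite [X in X + _](rmorphM (msubst c phi)).
rewrite [X in _ + X](rmorphM (msubst c phi)).
rewrite [X in d X](rmorphM (msubst c phi)).
rewrite (derM dd) qE rE.
by rewrite mulrDl -!mulrA [d (phi v) * _]mulrC.
Qed.

Lemma msubst_mder (R : idomainType) (I : choiceType) (S : comNzRingType)
    (c : {rmorphism R -> S}) (phi : I -> S) (psi : I -> mpol R I) (d : S -> S) :
  derivation d -> (forall a, d (c a) = 0) ->
  (forall i, msubst c phi (psi i) = d (phi i)) ->
  forall p, msubst c phi (mder psi p) = d (msubst c phi p).
Proof.
move=> dd dc dphi.
have mD p q : msubst c phi (p + q) = msubst c phi p + msubst c phi q.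
  exact: rmorphD (msubst c phi) p q.
have mM p q : msubst c phi (p * q) = msubst c phi p * msubst c phi q.
  exact: rmorphM (msubst c phi) p q.
elim/mpol_ind => [a|i|p q Ep Eq|p q Ep Eq].
- by rewrite mder_const msubst_const dc rmorph0.
- by rewrite mder_var msubst_var dphi.
- have -> : mder psi (p + q) = mder psi p + mder psi q by exact: mderD.
  have -> : msubst c phi (p + q) = msubst c phi p + msubst c phi q by exact: mD.
  by rewrite (derD dd) -Ep -Eq; exact: mD.
have -> : mder psi (p * q) = mder psi p * q + p * mder psi q by exact: mderM.
have -> : msubst c phi (p * q) = msubst c phi p * msubst c phi q by exact: mM.
rewrite (derM dd) -Ep -Eq; apply: etrans (mD _ _) _.
by congr (_ + _); exact: mM.
Qed.

Lemma rmorph_msubst (R : idomainType) (I : choiceType) (S T : comNzRingType)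
    (c : {rmorphism R -> S}) (phi : I -> S) (g : {rmorphism S -> T}) p :
  msubst (fun a => g (c a)) (fun i => g (phi i)) p = g (msubst c phi p).
Proof.
pose gc : {rmorphism R -> T} := g \o c.
rewrite -[LHS]/(msubst gc (fun i => g (phi i)) p).
elim/mpol_ind: p => [a|i|p q Ep Eq|p q Ep Eq].
- by rewrite !msubst_const.
- by rewrite !msubst_var.
- have -> : msubst c phi (p + q) = msubst c phi p + msubst c phi q.
    exact: rmorphD (msubst c phi) p q.
  by rewrite (rmorphD g) -Ep -Eq; exact: rmorphD (msubst gc _) p q.
have -> : msubst c phi (p * q) = msubst c phi p * msubst c phi q.
  exact: rmorphM (msubst c phi) p q.
by rewrite (rmorphM g) -Ep -Eq; exact: rmorphM (msubst gc _) p q.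
Qed.

Lemma seq_argmax (T : eqType) (f : T -> nat) (s : seq T) :
  s != [::] -> exists2 v, v \in s & {in s, forall w, (f w <= f v)%N}.
Proof.
elim: s => // a s IHs _; have [->|/IHs[v vs vmax]] := eqVneq s [::].
  by exists a => [|w]; rewrite inE // => /eqP->.
have [va|av] := leqP (f v) (f a).
  exists a; rewrite ?mem_head // => w; rewrite inE => /predU1P[->//|/vmax wv].
  exact: leq_trans wv va.
exists v; rewrite ?inE ?vs ?orbT // => w; rewrite inE => /predU1P[->|/vmax//].
exact: ltnW.
Qed.

(* Jacobian criterion: a nonzero relation of least degree could be            *)
(* differentiated along [E v], for [v] of maximal order in it.                *)
Lemma msubst_triangular_eq0 (R : numDomainType) (I : choiceType)
    (S : idomainType) (c : {rmorphism R -> S}) (phi : I -> S)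
    (ord : I -> nat) (E : I -> S -> S) :
  injective c -> (forall v, derivation (E v)) -> (forall v a, E v (c a) = 0) ->
  (forall v, E v (phi v) != 0) ->
  (forall v w, w != v -> (ord w <= ord v)%N -> E v (phi w) = 0) ->
  forall p : mpol R I, msubst c phi p = 0 -> p = 0.
Proof.
move=> cI dE Ec Ev Ew p; have [n] := ubnP (msize (p : {malg R[{cmonom I}]})).
elim: n p => // n IHn p pn p0.
pose s : seq I := flatten [seq enum_fset (finsupp m) | m : {cmonom I} <- msupp p].
have sP (m : {cmonom I}) i : m \in msupp p -> i \in finsupp m -> i \in s.
  by move=> mp mi; apply/flatten_mapP; exists m.
have [s0|/(seq_argmax ord)[v /flatten_mapP[m mp mv] vmax]] := eqVneq s [::].
  (* No variable occurs, so [p] is a constant and injectivity of [c] settles it. *)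
  have pE : p = mconst I (p : {malg R[{cmonom I}]})@_mone.
    apply/malgP => m; rewrite mcoeffC; case: eqVneq => [->//|m1].
    rewrite mulr0n; apply: mcoeff_outdom; apply: contraNN m1 => mp.
    apply/eqP/mdeg_eq0I; rewrite mdegE big1_seq // => i /andP[_ mi].
    by have := sP _ _ mp mi; rewrite s0.
  by move: p0; rewrite pE msubst_const => /eqP; rewrite (raddf_eq0 _ cI) => /eqP->;
    rewrite raddf0.
have : msubst c phi (mpartial v p) * E v (phi v) = 0.
  rewrite -(der_msubst (d := E v)) ?p0 ?(der0 (dE v)) // => k w kp kw wv.
  by apply: Ew => //; apply: vmax; apply: sP kp kw.
move=> /eqP; rewrite mulf_eq0 (negPf (Ev v)) orbF => /eqP dp0.
have mE : mmul (divcm m (ucm v)) (ucm v) = m.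
  apply/eqP/cmP => j; rewrite cmM divcmE cmU.
  by case: eqVneq => [<-|_]; rewrite ?subn0 ?addn0 // subnK // lt0n cmE_neq0.
(* The derivative is again a relation, of smaller degree. *)
have : mpartial v p = 0.
  apply: IHn dp0; rewrite msizeE big_seq.
  rewrite -ltnS (leq_trans _ pn) // ltnS; apply: (@leq_ltn_trans (msize (p : {malg R[{cmonom I}]})).-1); last first.
    by rewrite prednK // lt0n msize_eq0; apply: contraTneq mp => ->; rewrite msupp0.
  apply/bigmax_leqP_seq => k; rewrite -mcoeff_neq0 mcoeff_mpartial => kp _.
  have: mmul k (ucm v) \in msupp p.
    by rewrite -mcoeff_neq0; apply: contraNneq kp => ->; rewrite mul0rn.
  by move/msize_mdeg_lt; rewrite mdegM mdegU addn1; case: (msize _).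
(* In characteristic 0 the monomial [m], which contains [v], leaves a nonzero term in the
   derivative. *)
move/(congr1 (fun q : {malg R[{cmonom I}]} => q@_(divcm m (ucm v)))).
rewrite mcoeff_mpartial mE mcoeff0 => /eqP.
by rewrite Num.Theory.mulrn_eq0 /= mcoeff_eq0 mp.
Qed.

End Jacobian.

(** * Jets *)

Section PlaneDerivations.
Variables (S : comNzRingType) (dx dy : S -> S) (x y u : S).
Hypotheses (ddx : derivation dx) (ddy : derivation dy).
Hypothesis dC : forall q, dy (dx q) = dx (dy q).
Hypotheses (dxx : dx x = 1) (dxy : dx y = 0) (dyx : dy x = 0) (dyy : dy y = 1).

Local Notation n1 := (fun q => x * dx q + y * dy q).
Local Notation n2 := (fun q => dx u * dy q - dy u * dx q).
Local Notation uxx := (dx (dx u)).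
Local Notation uxy := (dx (dy u)).
Local Notation uyy := (dy (dy u)).
Local Notation i1 := (x * dx u + y * dy u).
Local Notation i2a := (x ^+ 2 * uxx + 2 * x * y * uxy + y ^+ 2 * uyy).
Local Notation i2b := (x * dy u * uxx - y * dx u * uyy + (y * dy u - x * dx u) * uxy).
Local Notation i2c := (dx u ^+ 2 * uyy - 2 * dx u * dy u * uxy + dy u ^+ 2 * uxx).

Let dE := (derB ddx, derB ddy, derN ddx, derN ddy, derD ddx, derD ddy,
  derM ddx, derM ddy, der_nat ddx, der_nat ddy, der1 ddx, der1 ddy, der0 ddx, der0 ddy, expr2,
  dxx, dxy, dyx, dyy, dC).

(** This identity and the next three only need commuting derivations with coordinates [x], [y]; they
    serve for polynomials as well as for fractions. *)
Lemma nabla11_u : i2a = n1 (n1 u) - n1 u.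
Proof. by rewrite /= !dE; ring. Qed.

Lemma nabla21_u : i2b = - n2 (n1 u).
Proof. by rewrite /= !dE; ring. Qed.

Lemma nabla_commutator q :
  i1 * (n1 (n2 q) - n2 (n1 q)) - i2b * n1 q - (i2a - i1) * n2 q = 0.
Proof. by rewrite /= !dE; ring. Qed.

Lemma nabla_syzygy :
  i1 * n2 i2b + i1 * n1 i2c - (3 * i2a - i1) * i2c + 3 * i2b ^+ 2 = 0.
Proof.
by rewrite /= !dE; ring.
Qed.

End PlaneDerivations.

Section JetDerivations.
Variable R : realType.
Local Notation "a %:F" := (@tofrac (jpoly R) a).
Implicit Types (p : jpoly R) (q : jrat R).

Lemma Dx_poly_derivation : derivation (@Dx_poly R).
Proof. exact: mder_derivation. Qed.
Lemma Dy_poly_derivation : derivation (@Dy_poly R).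
Proof. exact: mder_derivation. Qed.
Lemma Dx_poly_const c : Dx_poly (mconst jetvar c) = 0 :> jpoly R.
Proof. exact: mder_const. Qed.
Lemma Dy_poly_const c : Dy_poly (mconst jetvar c) = 0 :> jpoly R.
Proof. exact: mder_const. Qed.
Lemma Dx_poly_x : Dx_poly (jx R) = 1. Proof. exact: mder_var. Qed.
Lemma Dx_poly_y : Dx_poly (jy R) = 0. Proof. exact: mder_var. Qed.
Lemma Dy_poly_x : Dy_poly (jx R) = 0. Proof. exact: mder_var. Qed.
Lemma Dy_poly_y : Dy_poly (jy R) = 1. Proof. exact: mder_var. Qed.
Lemma Dx_poly_u i j : Dx_poly (ju R i j) = ju R i.+1 j.
Proof. exact: mder_var. Qed.
Lemma Dy_poly_u i j : Dy_poly (ju R i j) = ju R i j.+1.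
Proof. exact: mder_var. Qed.

Lemma jpoly_ind (P : jpoly R -> Prop) :
  (forall c, P (mconst jetvar c)) -> P (jx R) -> P (jy R) ->
  (forall i j, P (ju R i j)) -> (forall p r, P p -> P r -> P (p + r)) ->
  (forall p r, P p -> P r -> P (p * r)) -> forall p, P p.
Proof.
move=> Pc Px Py Pu; apply: (mpol_ind Pc) => v.
by case: v => [||i j]; [exact Px|exact Py|exact (Pu i j)].
Qed.

Lemma jpoly_sub (S : comNzRingType) (c : {rmorphism R -> S}) (X Y : S)
    (U : nat -> nat -> S) :
  exists f : {rmorphism jpoly R -> S},
    [/\ forall a, f (mconst jetvar a) = c a, f (jx R) = X, f (jy R) = Y &
        forall i j, f (ju R i j) = U i j].
Proof.
pose w v := match v with JX => X | JY => Y | JU i j => U i j end.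
exists (msubst c w : {rmorphism mpol R jetvar -> S}); split.
- exact: (msubst_const c w).
- exact: (msubst_var c w JX).
- exact: (msubst_var c w JY).
by move=> i j; exact: (msubst_var c w (JU i j)).
Qed.

Lemma jpoly_der (e : nat -> nat -> jpoly R) :
  exists E : jpoly R -> jpoly R, derivation E /\
    [/\ forall a, E (mconst jetvar a) = 0, E (jx R) = 0, E (jy R) = 0 &
        forall i j, E (ju R i j) = e i j].
Proof.
pose w v := match v with JX => 0 | JY => 0 | JU i j => e i j end.
exists (mder w); split; first exact: mder_derivation.
split.
- exact: (mder_const w).
- exact: (mder_var w JX).
- exact: (mder_var w JY).
by move=> i j; exact: (mder_var w (JU i j)).
Qed.

End JetDerivations.


(* [jets_ind], [jets_sub] and [jets_der] characterise P as the polynomial      *)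
(* algebra over R in x, y and the u i j.                                      *)
Record jets (R : realType) (P : idomainType) (cst : {rmorphism R -> P})
    (x y : P) (u : nat -> nat -> P) (dx dy : P -> P) : Prop := Jets {
  jets_ind : forall Q : P -> Prop,
    (forall c, Q (cst c)) -> Q x -> Q y -> (forall i j, Q (u i j)) ->
    (forall p r, Q p -> Q r -> Q (p + r)) ->
    (forall p r, Q p -> Q r -> Q (p * r)) -> forall p, Q p;
  jets_sub : forall (S : comNzRingType) (c : {rmorphism R -> S}) (X Y : S)
    (U : nat -> nat -> S), exists f : {rmorphism P -> S},
    [/\ forall a, f (cst a) = c a, f x = X, f y = Y &
        forall i j, f (u i j) = U i j];
  jets_der : forall e : nat -> nat -> P, exists E : P -> P, derivation E /\
    [/\ forall a, E (cst a) = 0, E x = 0, E y = 0 &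
        forall i j, E (u i j) = e i j];
  jets_cst_inj : injective cst;
  jets_dx : derivation dx;
  jets_dy : derivation dy;
  jets_dx_cst : forall c, dx (cst c) = 0;
  jets_dy_cst : forall c, dy (cst c) = 0;
  jets_dx_x : dx x = 1;
  jets_dx_y : dx y = 0;
  jets_dy_x : dy x = 0;
  jets_dy_y : dy y = 1;
  jets_dx_u : forall i j, dx (u i j) = u i.+1 j;
  jets_dy_u : forall i j, dy (u i j) = u i j.+1 }.

Lemma jets_jpoly (R : realType) :
  @jets R (jpoly R) (@mconst R jetvar) (jx R) (jy R) (ju R) (@Dx_poly R) (@Dy_poly R).
Proof.
split; [exact: jpoly_ind|exact: jpoly_sub|exact: jpoly_der|exact: mconst_inj
  |exact: Dx_poly_derivation|exact: Dy_poly_derivation|exact: Dx_poly_const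
  |exact: Dy_poly_const|exact: Dx_poly_x|exact: Dx_poly_y|exact: Dy_poly_x
  |exact: Dy_poly_y|exact: Dx_poly_u|exact: Dy_poly_u].
Qed.

(** * The prolonged action *)

Lemma der_div (K : fieldType) (d : K -> K) a b : derivation d -> b != 0 ->
  d (a / b) = (d a - a / b * d b) / b.
Proof.
move=> dd b0; apply: (mulIf b0); rewrite -[RHS]mulrA mulVf // mulr1.
by apply/eqP; rewrite eq_sym subr_eq -(derM dd) -mulrA mulVf // mulr1.
Qed.

Lemma frac_map_rmorphism (S : idomainType) (phi : {rmorphism S -> S}) :
  injective phi -> exists F : {rmorphism {fraction S} -> {fraction S}},
    frac_map phi = F.
Proof.
move=> phiI.
pose Fz := GRing.isZmodMorphism.Build _ _ _ (frac_map_is_zmod_morphism phiI).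
pose Fm := GRing.isMonoidMorphism.Build _ _ _ (frac_map_is_monoid_morphism phiI).
pose F : {rmorphism {fraction S} -> {fraction S}} :=
  HB.pack (frac_map phi) Fz Fm.
by exists F.
Qed.

Section Jets.
Variables (R : realType) (P : idomainType) (cst : {rmorphism R -> P}).
Variables (x y : P) (u : nat -> nat -> P) (dx dy : P -> P).
Hypothesis J : jets cst x y u dx dy.
Local Notation K := {fraction P}.
Local Notation "a %:F" := (@tofrac P a).
Local Notation Dx := (frac_der dx).
Local Notation Dy := (frac_der dy).
Let ddx := jets_dx J.
Let ddy := jets_dy J.
Let jE := (jets_dx_cst J, jets_dy_cst J, jets_dx_x J, jets_dx_y J, jets_dy_x J,
  jets_dy_y J, jets_dx_u J, jets_dy_u J).
Let dE := (derD ddx, derD ddy, derB ddx, derB ddy, derN ddx, derN ddy,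
  derM ddx, derM ddy, der1 ddx, der1 ddy, der0 ddx, der0 ddy).

Lemma der_jets_eq0 (d : P -> P) :
  derivation d -> (forall c, d (cst c) = 0) ->
  d x = 0 -> d y = 0 -> (forall i j, d (u i j) = 0) -> forall p, d p = 0.
Proof.
move=> dd dc d_x d_y d_u; apply: (jets_ind J) => // p q p0 q0.
  by rewrite (derD dd) p0 q0 addr0.
by rewrite (derM dd) p0 q0 mul0r mulr0 addr0.
Qed.

Lemma jets_dC p : dy (dx p) = dx (dy p).
Proof.
have dd := der_comm ddy ddx.
apply/eqP; rewrite -subr_eq0; apply/eqP; move: p; apply: (der_jets_eq0 dd).
- by move=> c; rewrite !jE !dE subrr.
- by rewrite !jE !dE subrr.
- by rewrite !jE !dE subrr.
by move=> i j; rewrite !jE subrr.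
Qed.

Lemma jets_Dx : derivation Dx. Proof. exact: frac_der_derivation. Qed.
Lemma jets_Dy : derivation Dy. Proof. exact: frac_der_derivation. Qed.
Lemma jets_Dx_tofrac p : Dx p%:F = (dx p)%:F.
Proof. exact: frac_der_tofrac. Qed.
Lemma jets_Dy_tofrac p : Dy p%:F = (dy p)%:F.
Proof. exact: frac_der_tofrac. Qed.

Lemma jets_DC q : Dy (Dx q) = Dx (Dy q).
Proof.
have dd := der_comm jets_Dy jets_Dx.
apply/eqP; rewrite -subr_eq0; apply/eqP; elim/frac_ind: q => a b b0.
have poly0 p : Dy (Dx p%:F) - Dx (Dy p%:F) = 0.
  by rewrite !(jets_Dx_tofrac, jets_Dy_tofrac) jets_dC subrr.
by rewrite (der_div _ dd) ?tofrac_eq0 // !poly0 mulr0 subrr mul0r.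
Qed.

Lemma jets_uE i j : u i j = iter i dx (iter j dy (u 0%N 0%N)).
Proof.
have -> : iter j dy (u 0%N 0%N) = u 0%N j by elim: j => //= j ->; rewrite jE.
by elim: i => //= i <-; rewrite jE.
Qed.

(* The prolonged action of the matrix with rows (a, b) and (c, d); its        *)
(* inverse has rows (d, -b) and (-c, a).                                      *)
Section Prolongation.
Variables a b c d : R.

Definition prolong_dx p := cst d * dx p - cst c * dy p.
Definition prolong_dy p := cst a * dy p - cst b * dx p.

Definition is_prolongation (f : P -> P) : Prop :=
  [/\ forall r, f (cst r) = cst r, f x = cst a * x + cst b * y,
      f y = cst c * x + cst d * y &
      forall i j, f (u i j) = iter i prolong_dx (iter j prolong_dy (u 0%N 0%N))].

Hypothesis det1 : a * d - b * c = 1.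
Let cdet : cst a * cst d - cst b * cst c = 1.
Proof. by rewrite -!rmorphM -rmorphB det1 rmorph1. Qed.

Variable f : {rmorphism P -> P}.
Hypothesis pf : is_prolongation f.

Lemma prolong_dC p : prolong_dy (prolong_dx p) = prolong_dx (prolong_dy p).
Proof. by rewrite /prolong_dx /prolong_dy !(dE, jE) jets_dC; ring. Qed.

(** On [x] and [y] this is the determinant condition; on [u i j] it is the definition of the action,
    with [prolong_dC] moving the new [prolong_dy] inside. *)
Lemma prolong_d p : f (dx p) = prolong_dx (f p) /\ f (dy p) = prolong_dy (f p).
Proof.
have [fc fx fy fu] := pf.
elim/(jets_ind J): p => [r|||i j|p q [px py] [qx qy]|p q [px py] [qx qy]].
- by rewrite /prolong_dx /prolong_dy fc !jE rmorph0 !mulr0 subrr.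
- rewrite /prolong_dx /prolong_dy fx !(dE, jE, mulr0, mulr1) rmorph1 rmorph0 -cdet.
  by split; ring.
- rewrite /prolong_dx /prolong_dy fy !(dE, jE, mulr0, mulr1) rmorph1 rmorph0 -cdet.
  by split; ring.
- rewrite !jE !fu; split=> //; elim: i => // i IHi.
  by rewrite !iterS IHi prolong_dC.
- rewrite !dE !rmorphD px py qx qy /prolong_dx /prolong_dy !dE.
  by split; ring.
rewrite !dE !rmorphD !rmorphM px py qx qy /prolong_dx /prolong_dy !dE.
by split; ring.
Qed.

End Prolongation.

Lemma prolong_unique (a b c d : R) (f g : {rmorphism P -> P}) :
  is_prolongation a b c d f -> is_prolongation a b c d g -> f = g :> (P -> P).
Proof.
move=> [fc fx fy fu] [gc gx gy gu]; apply/funext => p.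
elim/(jets_ind J): p => [r|||i j|p q Ep Eq|p q Ep Eq].
- by rewrite fc gc.
- by rewrite fx gx.
- by rewrite fy gy.
- by rewrite fu gu.
- by rewrite !rmorphD Ep Eq.
by rewrite !rmorphM Ep Eq.
Qed.

Lemma prolong_exists (a b c d : R) :
  exists f : {rmorphism P -> P}, is_prolongation a b c d f.
Proof. exact: (jets_sub J). Qed.

(** [g] belongs to the inverse matrix. By [prolong_d], [f] turns the operators defining [g] on the
    [u i j] back into [dx] and [dy]. *)
Lemma prolong_cancel (a b c d : R) (f g : {rmorphism P -> P}) :
  a * d - b * c = 1 -> is_prolongation a b c d f ->
  is_prolongation d (- b) (- c) a g -> cancel g f.
Proof.
move=> det1 pf [gc gx gy gu] p; have [fc fx fy fu] := pf.
have cdet : cst a * cst d - cst b * cst c = 1.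
  by rewrite -!rmorphM -rmorphB det1 rmorph1.
elim/(jets_ind J): p => [r|||i j|p q pE qE|p q pE qE].
- by rewrite gc fc.
- rewrite gx rmorphD !rmorphM fx fy !fc rmorphN -[RHS]mul1r -cdet; ring.
- rewrite gy rmorphD !rmorphM fx fy !fc rmorphN -[RHS]mul1r -cdet; ring.
- rewrite gu [in RHS]jets_uE.
  have pdx p := proj1 (prolong_d det1 pf p).
  have pdy p := proj2 (prolong_d det1 pf p).
  have fdx p : f (prolong_dx (- c) a p) = dx (f p).
    rewrite /prolong_dx rmorphB !rmorphM !fc pdx pdy.
    by rewrite /prolong_dx /prolong_dy rmorphN -[RHS]mul1r -cdet; ring.
  have fdy p : f (prolong_dy d (- b) p) = dy (f p).
    rewrite /prolong_dy rmorphB !rmorphM !fc pdx pdy.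
    by rewrite /prolong_dx /prolong_dy rmorphN -[RHS]mul1r -cdet; ring.
  have fu0 : f (u 0%N 0%N) = u 0%N 0%N by rewrite fu.
  elim: i => [|i IHi]; last by rewrite !iterS fdx IHi.
  by elim: j => //= j IHj; rewrite fdy IHj.
- by rewrite !rmorphD pE qE.
by rewrite !rmorphM pE qE.
Qed.

Lemma prolong_inj (a b c d : R) (f : {rmorphism P -> P}) :
  a * d - b * c = 1 -> is_prolongation a b c d f -> injective f.
Proof.
move=> det1 pf; have [g pg] := prolong_exists d (- b) (- c) a.
apply: can_inj (prolong_cancel (a := d) (b := - b) (c := - c) (d := a) _ pg _).
  by rewrite mulrN mulNr opprK -[RHS]det1 mulrC.
by rewrite !opprK.
Qed.

Lemma prolong_frac (a b c d : R) (f : {rmorphism P -> P})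
    (F : {rmorphism K -> K}) :
  a * d - b * c = 1 -> is_prolongation a b c d f -> frac_map f = F ->
  forall q, F (Dx q) = (cst d)%:F * Dx (F q) - (cst c)%:F * Dy (F q) /\
            F (Dy q) = (cst a)%:F * Dy (F q) - (cst b)%:F * Dx (F q).
Proof.
move=> det1 pf FE q; have fI := prolong_inj det1 pf.
have Fp p : F p%:F = (f p)%:F by rewrite -FE frac_map_tofrac.
have Fx p : F (Dx p%:F) = (cst d)%:F * Dx (F p%:F) - (cst c)%:F * Dy (F p%:F).
  rewrite jets_Dx_tofrac !Fp jets_Dx_tofrac jets_Dy_tofrac -!tofracM -tofracB.
  by congr (_%:F); have [] := prolong_d det1 pf p.
have Fy p : F (Dy p%:F) = (cst a)%:F * Dy (F p%:F) - (cst b)%:F * Dx (F p%:F).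
  rewrite jets_Dy_tofrac !Fp jets_Dx_tofrac jets_Dy_tofrac -!tofracM -tofracB.
  by congr (_%:F); have [] := prolong_d det1 pf p.
elim/frac_ind: q => m n n0.
have nF0 : n%:F != 0 by rewrite tofrac_eq0.
have FnF0 : F n%:F != 0 by rewrite fmorph_eq0.
have Fdiv : F (m%:F / n%:F) = F m%:F / F n%:F by rewrite fmorph_div.
have dFE (D : K -> K) : derivation D -> F (D (m%:F / n%:F)) =
    (F (D m%:F) - F m%:F / F n%:F * F (D n%:F)) / F n%:F.
  by move=> dD; rewrite (der_div _ dD) // -Fdiv -rmorphM -rmorphB -fmorph_div.
rewrite (dFE _ jets_Dx) (dFE _ jets_Dy) Fdiv !Fx !Fy.
rewrite (der_div _ jets_Dx) // (der_div _ jets_Dy) //.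
have E (L : comPzRingType) (r s t V a1 a2 b1 b2 : L) :
  (r * a1 - s * a2 - t * (r * b1 - s * b2)) * V =
  r * ((a1 - t * b1) * V) - s * ((a2 - t * b2) * V) by ring.
by split; apply: E.
Qed.

End Jets.

(** * Principal symbols *)

Section SymbolCalculus.
Variables (R : realType) (P : idomainType) (cst : {rmorphism R -> P}).
Variables (x y : P) (u : nat -> nat -> P) (dx dy : P -> P).
Hypothesis J : jets cst x y u dx dy.
Let ddx := jets_dx J.
Let ddy := jets_dy J.
Let jE := (jets_dx_cst J, jets_dy_cst J, jets_dx_x J, jets_dx_y J, jets_dy_x J,
  jets_dy_y J, jets_dx_u J, jets_dy_u J).
Local Notation ux := (u 1%N 0%N).
Local Notation uy := (u 0%N 1%N).
Local Notation n1 := (fun p => x * dx p + y * dy p).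
Local Notation n2 := (fun p => ux * dy p - uy * dx p).
Local Notation i1 := (x * ux + y * uy).
Local Notation i2c :=
  (ux ^+ 2 * u 0%N 2%N - 2 * ux * uy * u 1%N 1%N + uy ^+ 2 * u 2%N 0%N).

(** The vertical derivation with value 1 on every [u 1 j] and 0 on the other [u i j] maps [i1] to
    [x], and [x] is nonzero because [dx x = 1]. *)
Lemma i1_neq0 : i1 != 0.
Proof.
have [E [dE [_ Ex Ey Eu]]] := jets_der J (fun i j => (i == 1)%:R).
apply/eqP => /(congr1 E); rewrite (der0 dE) (derD dE) !(derM dE) Ex Ey !Eu.
rewrite !mul0r !add0r mulr1 mulr0 addr0 => x0.
by have /eqP := jets_dx_x J; rewrite x0 (der0 ddx) eq_sym oner_eq0.
Qed.

Definition vertical (E : P -> P) : Prop :=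
  derivation E /\ [/\ forall c, E (cst c) = 0, E x = 0 & E y = 0].

(** Being a function on the space of [k]-jets, expressed by vertical derivations instead of
    monomials, so that commutators can be applied. *)
Definition order_le (k : nat) (p : P) : Prop :=
  forall E, vertical E -> (forall a b, (a + b <= k)%N -> E (u a b) = 0) -> E p = 0.

(** The commutator of [E] with the derivation is vertical and kills the jet variables of order at
    most [k], hence kills [p]. *)
Lemma order_le_nabla (v w : P) k p :
  (forall E, vertical E -> (forall a b, (a + b <= k.+1)%N -> E (u a b) = 0) ->
     E v = 0 /\ E w = 0) ->
  order_le k p -> order_le k.+1 (v * dx p + w * dy p).
Proof.
move=> vw pk E Ev E0; have [Ev0 Ew0] := vw E Ev E0.
have [dE [Ec Ex Ey]] := Ev.
pose n q := v * dx q + w * dy q; have dn : derivation n by apply: der_comb.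
have EnC : E (n p) - n (E p) = 0.
  apply: (pk (fun q => E (n q) - n (E q))) => [|a b abk].
    split; first exact: der_comm.
    rewrite /n; split=> [c||]; rewrite ?Ec ?Ex ?Ey !jE !(der0 ddx, der0 ddy);
      by rewrite ?mulr0 ?mulr1 ?addr0 ?add0r ?(der0 dE) ?Ev0 ?Ew0 subr0.
  rewrite (E0 a b) ?(leq_trans abk) // (der0 dn) subr0 /n !jE.
  rewrite (derD dE) !(derM dE) Ev0 Ew0 (E0 a.+1 b) ?(E0 a b.+1) ?addnS ?addSn //.
  by rewrite !mul0r !mulr0 !addr0.
move/eqP: EnC; rewrite subr_eq0 => /eqP ->; rewrite (pk E) ?(der0 dn) // => a b abk.
by apply: E0; apply: leq_trans abk _.
Qed.

Lemma order_le_n1 k p : order_le k p -> order_le k.+1 (n1 p).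
Proof. by apply: order_le_nabla => E [_ [_ Ex Ey]]. Qed.

Lemma order_le_n2 k p : order_le k p -> order_le k.+1 (n2 p).
Proof.
move=> pk; rewrite /= addrC -mulNr; apply: order_le_nabla pk => E [dE _] E0.
by rewrite (derN dE) !E0 ?oppr0.
Qed.

Definition functional (L : {poly P} -> P) : Prop :=
  (forall q r, L (q + r) = L q + L r) /\ (forall c q, L (c *: q) = c * L q).

(* The principal symbols of D_x and D_y, multiplied by I1, in the coordinates *)
(* (1, 'X) dual to the frame (x, y), (- u_y, u_x).                            *)
Definition symbol_x : {poly P} := ux%:P - y *: 'X.
Definition symbol_y : {poly P} := uy%:P + x *: 'X.

(** The vertical direction of pure order [k] dual to symbols through [L]; binary forms of degree [k]
    are dehomogenised to polynomials in ['X]. *)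
Definition symbol_der k L (E : P -> P) : Prop :=
  vertical E /\ forall a b,
    E (u a b) = if (a + b == k)%N then L (symbol_x ^+ a * symbol_y ^+ b) else 0.

Lemma symbol_der_exists k L : exists E, symbol_der k L E.
Proof.
have [E [dE [Ec Ex Ey Eu]]] := jets_der J (fun a b =>
  if (a + b == k)%N then L (symbol_x ^+ a * symbol_y ^+ b) else 0).
by exists E.
Qed.

(** [s] is the principal symbol of [p] times I1^k, recovered by testing against all functionals
    [L]. *)
Definition has_symbol k p (s : {poly P}) : Prop :=
  order_le k p /\ forall L E, functional L -> symbol_der k L E -> E p = L s.

(** Applying a derivation multiplies the symbol by [t]. With [E'] the direction of order [k] for the
    functional [L (t * q)] in [q], the commutator of [E] with the derivation minus [E'] kills all
    jet variables of order at most [k], hence [p]. *)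
Lemma has_symbol_nabla (v w : P) (t : {poly P}) k p s :
  (forall E, vertical E -> (forall a b, (a + b <= k)%N -> E (u a b) = 0) ->
     E v = 0 /\ E w = 0) ->
  v *: symbol_x + w *: symbol_y = t ->
  has_symbol k p s -> forall L E, functional L -> symbol_der k.+1 L E ->
  E (v * dx p + w * dy p) = L (t * s).
Proof.
move=> vw tE [pk ps] L E fL [vE Eu].
have E0 a b : (a + b <= k)%N -> E (u a b) = 0 by move=> abk; rewrite Eu ltn_eqF.
have [Ev0 Ew0] := vw E vE E0; have [dE [Ec Ex Ey]] := vE.
pose n q := v * dx q + w * dy q; have dn : derivation n by apply: der_comb.
pose L' q := L (t * q).
have fL' : functional L'.
  by split=> [q r|c q]; rewrite /L' ?mulrDr ?(proj1 fL) // -scalerAr (proj2 fL).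
have [E' sE'] := symbol_der_exists k L'; have [[dE' [Ec' Ex' Ey']] Eu'] := sE'.
rewrite -/(L' s) -(ps _ _ fL' sE'); apply/eqP; rewrite -subr_eq0; apply/eqP.
have <- : E (n p) - n (E p) - E' p = E (n p) - E' p.
  by rewrite (pk E vE E0) (der0 dn) subr0.
apply: (pk (fun q => E (n q) - n (E q) - E' q)) => [|a b abk].
  split; first by apply: der_sub => //; exact: der_comm.
  rewrite /n; split=> [c||]; rewrite ?Ec ?Ex ?Ey ?Ec' ?Ex' ?Ey' !jE;
    rewrite !(der0 ddx, der0 ddy);
    by rewrite ?mulr0 ?mulr1 ?addr0 ?add0r ?(der0 dE) ?Ev0 ?Ew0 !subr0.
rewrite (E0 _ _ abk) (der0 dn) subr0 /n !jE (derD dE) !(derM dE) Ev0 Ew0.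
rewrite !mul0r !add0r !Eu Eu' addSn addnS eqSS.
case: ifP => _; last by rewrite !mulr0 subr0 addr0.
rewrite -!(proj2 fL) -(proj1 fL) /L' -tE; apply/eqP; rewrite subr_eq0; apply/eqP.
congr (L _); rewrite mulrDl !exprS -!scalerAl; congr (_ + _); congr (_ *: _).
  by rewrite mulrA.
by rewrite mulrCA.
Qed.

Lemma has_symbol_n1 k p s :
  has_symbol k p s -> has_symbol k.+1 (n1 p) (i1 *: s).
Proof.
move=> ps; split; first by apply: order_le_n1; case: ps.
rewrite -mul_polyC; apply: has_symbol_nabla ps => [E [_ [_ Ex Ey]]//|].
by rewrite /symbol_x /symbol_y -!mul_polyC !rmorphD !rmorphM /=; ring.
Qed.

(** The order is at least 1 here so that [E] kills the coefficients [ux], [uy] of [n2]. *)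
Lemma has_symbol_n2 k p s :
  has_symbol k.+1 p s -> has_symbol k.+2 (n2 p) (i1 *: ('X * s)).
Proof.
move=> ps; split; first by apply: order_le_n2; case: ps.
rewrite /= addrC -mulNr -mul_polyC mulrA; apply: has_symbol_nabla ps.
  by move=> E [dE _] E0; rewrite (derN dE) !E0 ?oppr0.
by rewrite /symbol_x /symbol_y -!mul_polyC !rmorphD !rmorphM rmorphN /=; ring.
Qed.

Lemma has_symbol_u : has_symbol 0 (u 0%N 0%N) 1.
Proof.
split=> [E _ E0|L E _ [_ Eu]]; first exact: E0.
by rewrite Eu mulr1.
Qed.

Lemma has_symbol_i1 : has_symbol 1 i1 (i1 *: 1).
Proof.
have -> : i1 = n1 (u 0%N 0%N) by rewrite !jE.
by have := has_symbol_n1 has_symbol_u; rewrite !jE.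
Qed.

Lemma has_symbol_i2c : has_symbol 2 i2c (i1 ^+ 2 *: 'X^2).
Proof.
split=> [E [dE _] E0|L E [LD LZ] [[dE _] Eu]].
  rewrite !(derB dE, derD dE, derM dE, expr2, der_nat dE) !E0 //.
  by rewrite !(der1 dE, mulr0, mul0r, addr0, subr0).
rewrite !(derB dE, derD dE, derM dE, expr2, der_nat dE) !Eu /=.
rewrite !(der1 dE, mulr0, mul0r, addr0, add0r).
have LN q : L (- q) = - L q by rewrite -scaleN1r LZ mulN1r.
rewrite -!LZ -LN -!LD; congr (L _).
rewrite /symbol_x /symbol_y -!mul_polyC.
rewrite !(rmorphD, rmorphM, rmorphN, rmorph_nat) /=; ring.
Qed.

(* The indices of the generators I0, \nabla_2^j \nabla_1^i I1 and             *)
(* \nabla_2^j I2c of a polynomial algebra.                                    *)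
Definition nidx : Type := (unit + nat * nat + nat)%type.

Definition nval (v : nidx) : P :=
  match v with
  | inl (inl _) => u 0%N 0%N
  | inl (inr (i, j)) => iter j n2 (iter i n1 i1)
  | inr j => iter j n2 i2c
  end.

Definition nord (v : nidx) : nat :=
  match v with inl (inl _) => 0 | inl (inr (i, j)) => (j + i).+1 | inr j => j.+2 end.

Definition ndeg (v : nidx) : nat :=
  match v with inl (inl _) => 0 | inl (inr (i, j)) => j | inr j => j.+2 end.

Lemma has_symbol_nval v : has_symbol (nord v) (nval v) (i1 ^+ nord v *: 'X^(ndeg v)).
Proof.
case: v => [[t|[i j]]|j] /=.
- by rewrite !expr0 scale1r; exact: has_symbol_u.
- elim: j => [|j IHj] /=.
    rewrite add0n; elim: i => [|i IHi] /=; first exact: has_symbol_i1.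
    by have := has_symbol_n1 IHi; rewrite scalerA -exprS.
  by have := has_symbol_n2 IHj; rewrite -scalerAr -exprS scalerA -exprS.
elim: j => [|j IHj] /=; first exact: has_symbol_i2c.
by have := has_symbol_n2 IHj; rewrite -scalerAr -exprS scalerA -exprS.
Qed.

(** In order k >= 2 the derivatives of I1 take the degrees 0, ..., k - 1 and \nabla_2^(k-2) I2c
    takes the degree k; in orders 0 and 1 there is one generator each. *)
Lemma nord_ndeg_inj v w : nord v = nord w -> ndeg v = ndeg w -> v = w.
Proof.
case: v w => [[[]|[i j]]|j] [[[]|[k l]]|l] //=.
- by move=> [e1] e2; move: e1; rewrite e2 => /addnI ->.
- by move=> [e1] e2; have := leq_addr i j; rewrite e1 e2 ltnn.
- by move=> [e1] e2; have := leq_addr k l; rewrite -e1 -e2 ltnn.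
- by move=> e1 [->].
Qed.

Lemma functional_coef j : functional (fun q : {poly P} => q`_j).
Proof. by split=> [q r|c q]; rewrite ?coefD ?coefZ. Qed.

(** [E v] reads off the coefficient of the symbol monomial of [v]. It kills the other generators of
    the same order and all those of lower order, so the Jacobian criterion applies. *)
Lemma normal_independent (p : mpol R nidx) : msubst cst nval p = 0 -> p = 0.
Proof.
have exE v := cid (symbol_der_exists (nord v) (fun q : {poly P} => q`_(ndeg v))).
pose E v := projT1 (exE v); have sE v : symbol_der _ _ (E v) := projT2 (exE v).
apply: (msubst_triangular_eq0 (ord := nord) (E := E)).
- exact: jets_cst_inj J.
- by move=> v; have [[]] := sE v.
- by move=> v a; have [[_ []]] := sE v.
- move=> v; have [_ /(_ _ _ (functional_coef _) (sE v)) ->] := has_symbol_nval v.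
  by rewrite coefZ coefXn eqxx mulr1 expf_neq0 // i1_neq0.
move=> v w wv; rewrite leq_eqVlt => /orP[/eqP vw|wltv].
  have [_] := has_symbol_nval w; rewrite vw => /(_ _ _ (functional_coef _) (sE v)) ->.
  rewrite coefZ coefXn; case: eqP => [dvw|_]; last by rewrite mulr0.
  by rewrite (nord_ndeg_inj vw) ?eqxx in wv.
have [wk _] := has_symbol_nval w; apply: wk; first by have [] := sE v.
move=> a b abk; have [_ ->] := sE v.
by rewrite (ltn_eqF (leq_ltn_trans abk wltv)).
Qed.

End SymbolCalculus.

(** * Syzygies *)

Section Completeness.
Variables (R : realType) (F : comNzRingType) (c : {rmorphism R -> F}).
Variables (D1 D2 : F -> F) (i0 i2c : F) (C : F -> Prop).
Hypotheses (dD1 : derivation D1) (dD2 : derivation D2).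
Hypotheses (D1c : forall a, D1 (c a) = 0) (D2c : forall a, D2 (c a) = 0).
Hypotheses (C0 : C 0) (CD : forall p q, C p -> C q -> C (p + q)).
Hypotheses (CM : forall p q, C q -> C (p * q)).
Hypotheses (CD1 : forall p, C p -> C (D1 p)) (CD2 : forall p, C p -> C (D2 p)).
Let i1 := D1 i0.
Let i2a := D1 i1 - i1.
Let i2b := - D2 i1.
Hypothesis CR1 : C (D2 i0).
Hypothesis CR2 : forall p,
  C (i1 * (D1 (D2 p) - D2 (D1 p)) - i2b * D1 p - (i2a - i1) * D2 p).
Hypothesis CR3 :
  C (i1 * D2 i2b + i1 * D1 i2c - (3 * i2a - i1) * i2c + 3 * i2b ^+ 2).

Definition nsym (v : nidx) : F :=
  match v with
  | inl (inl _) => i0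
  | inl (inr (i, j)) => iter j D2 (iter i D1 (D1 i0))
  | inr j => iter j D2 i2c
  end.

(** Existence of a normal form modulo [C]. The power of [i1] is there because R2 and R3 have leading
    coefficient [i1]. *)
Definition reducible (p : F) : Prop :=
  exists n N, C (i1 ^+ n * p - msubst c nsym N).
Local Notation L := reducible.

Lemma reducible_normal N : L (msubst c nsym N).
Proof. by exists 0, N; rewrite expr0 mul1r subrr. Qed.

Lemma reducible_cst a : L (c a).
Proof. by have := reducible_normal (mconst _ a); rewrite msubst_const. Qed.

Lemma reducible_nsym v : L (nsym v).
Proof. by have := reducible_normal (mvar _ v); rewrite msubst_var. Qed.

Lemma reducible_C p : C p -> L p.
Proof. by move=> Cp; exists 0, 0; rewrite rmorph0 subr0; apply: CM. Qed.

Lemma reducible_i1 : L i1.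
Proof. exact: (reducible_nsym (inl (inr (0, 0)))). Qed.

Lemma reducible_i1X n p : L (i1 ^+ n * p) -> L p.
Proof. by move=> [m [N CN]]; exists (m + n)%N, N; rewrite exprD -mulrA. Qed.

Lemma reducibleM p q : L p -> L q -> L (p * q).
Proof.
move=> [n [N CN]] [m [M CMm]]; exists (n + m)%N, (N * M).
have -> : i1 ^+ (n + m) * (p * q) - msubst c nsym (N * M) =
    i1 ^+ m * q * (i1 ^+ n * p - msubst c nsym N) +
    msubst c nsym N * (i1 ^+ m * q - msubst c nsym M).
  by rewrite rmorphM exprD; ring.
by apply: CD; apply: CM.
Qed.

Lemma reducibleD p q : L p -> L q -> L (p + q).
Proof.
move=> [n [N CN]] [m [M CMm]].
pose X : mpol R nidx := mvar R (inl (inr (0, 0))).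
have XE : msubst c nsym X = i1 by rewrite msubst_var.
have fE (A B : comNzRingType) (f : {rmorphism A -> B}) (V W Z : A) :
    f (V ^+ m * W + V ^+ n * Z) = f V ^+ m * f W + f V ^+ n * f Z.
  by rewrite rmorphD !rmorphM !rmorphXn.
have XNM : msubst c nsym (X ^+ m * N + X ^+ n * M) =
    i1 ^+ m * msubst c nsym N + i1 ^+ n * msubst c nsym M.
  by rewrite -XE; apply: (fE _ _ (msubst c nsym)).
exists (n + m)%N, (X ^+ m * N + X ^+ n * M); rewrite XNM.
have -> : i1 ^+ (n + m) * (p + q) -
    (i1 ^+ m * msubst c nsym N + i1 ^+ n * msubst c nsym M) =
    i1 ^+ m * (i1 ^+ n * p - msubst c nsym N) +
    i1 ^+ n * (i1 ^+ m * q - msubst c nsym M).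
  by rewrite exprD; ring.
by apply: CD; apply: CM.
Qed.

Lemma reducibleN p : L p -> L (- p).
Proof.
by move=> Lp; rewrite -mulN1r; apply: reducibleM Lp; rewrite -(rmorph1 c) -rmorphN;
  apply: reducible_cst.
Qed.

Lemma reducibleB p q : L p -> L q -> L (p - q).
Proof. by move=> Lp Lq; apply: reducibleD Lp (reducibleN Lq). Qed.

Lemma reducible_nat n : L n%:R.
Proof. by rewrite -(rmorph_nat c); apply: reducible_cst. Qed.

Lemma reducibleX p n : L p -> L (p ^+ n).
Proof.
move=> Lp; elim: n => [|n IHn]; first by rewrite expr0 -(rmorph1 c); apply: reducible_cst.
by rewrite exprS; apply: reducibleM.
Qed.

(** Differentiating the congruence between [i1 ^+ n * p] and its normal form reduces the claim to
    the generators; the extra term [D (i1 ^+ n) * p] is reducible as well. *)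
Lemma reducible_der D : derivation D -> (forall a, D (c a) = 0) ->
  (forall p, C p -> C (D p)) -> (forall v, L (D (nsym v))) ->
  forall p, L p -> L (D p).
Proof.
move=> dD Dc CDD Dv p Lp; case: (Lp) => n [N CN].
have DN : L (D (msubst c nsym N)).
  elim/mpol_ind: N {CN} => [a|v|M N DM DN|M N DM DN].
  - by rewrite msubst_const Dc -(rmorph0 c); apply: reducible_cst.
  - by rewrite msubst_var; apply: Dv.
  - by rewrite rmorphD (derD dD); apply: reducibleD.
  rewrite rmorphM (derM dD).
  by apply: reducibleD; apply: reducibleM => //; apply: reducible_normal.
apply: (reducible_i1X (n := n)).
have -> : i1 ^+ n * D p = D (i1 ^+ n * p - msubst c nsym N) +
    D (msubst c nsym N) - D (i1 ^+ n) * p.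
  by rewrite (derB dD) (derM dD); ring.
apply: reducibleB; first by apply: reducibleD => //; apply/reducible_C/CDD.
apply: reducibleM => //; rewrite (derXn _ _ dD) -mulr_natr.
apply: reducibleM (reducible_nat _); apply: reducibleM.
  by apply: reducibleX; apply: reducible_i1.
exact: (Dv (inl (inr (0, 0)))).
Qed.

(** [D2] maps generators to generators, except [i0], whose image is the consequence R1. *)
Lemma reducible_D2 p : L p -> L (D2 p).
Proof.
apply: reducible_der => // -[[t|[i j]]|j].
- exact: reducible_C.
- exact: (reducible_nsym (inl (inr (i, j.+1)))).
exact: (reducible_nsym (inr j.+1)).
Qed.

Lemma reducible_i2b : L i2b.
Proof. by apply/reducibleN/reducible_D2/reducible_i1. Qed.

Lemma reducible_i2a : L i2a.
Proof.
apply: reducibleB reducible_i1.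
exact: (reducible_nsym (inl (inr (1, 0)))).
Qed.

(** R2 solved for [i1 * D1 (D2 p)]. *)
Lemma reducible_D12 p : L p -> L (D1 p) -> L (D1 (D2 p)).
Proof.
move=> Lp L1p; apply: (reducible_i1X (n := 1)); rewrite expr1.
have -> : i1 * D1 (D2 p) =
    (i1 * (D1 (D2 p) - D2 (D1 p)) - i2b * D1 p - (i2a - i1) * D2 p) +
    (i1 * D2 (D1 p) + i2b * D1 p + (i2a - i1) * D2 p) by ring.
have [[L1 La] Lb] := (reducible_i1, reducible_i2a, reducible_i2b).
apply: reducibleD; first exact: reducible_C.
apply: reducibleD; first by apply: reducibleD; apply: reducibleM => //; apply: reducible_D2.
by apply: reducibleM; [apply: reducibleB|apply: reducible_D2].
Qed.

Lemma reducible_D1 p : L p -> L (D1 p).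
Proof.
have [[L1 La] Lb] := (reducible_i1, reducible_i2a, reducible_i2b).
have Lc : L i2c by exact: (reducible_nsym (inr 0)).
apply: reducible_der => // -[[t|[i j]]|j].
- exact: reducible_i1.
- elim: j => [|j IHj]; first exact: (reducible_nsym (inl (inr (i.+1, 0)))).
  by apply: reducible_D12 => //; apply: (reducible_nsym (inl (inr (i, j)))).
elim: j => [|j IHj]; last by apply: reducible_D12 => //; apply: (reducible_nsym (inr j)).
(* R3 solved for [i1 * D1 i2c]. *)
apply: (reducible_i1X (n := 1)); rewrite expr1 /=.
have -> : i1 * D1 i2c =
    (i1 * D2 i2b + i1 * D1 i2c - (3 * i2a - i1) * i2c + 3 * i2b ^+ 2) -
    (i1 * D2 i2b - (3 * i2a - i1) * i2c + 3 * i2b ^+ 2) by ring.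
apply: reducibleB; first exact: reducible_C.
apply: reducibleD; last by apply: reducibleM (reducible_nat _) (reducibleX _ _).
apply: reducibleB; first by apply: reducibleM => //; apply: reducible_D2.
by apply: reducibleM Lc; apply: reducibleB => //; apply: reducibleM (reducible_nat _) _.
Qed.

Variables (P : idomainType) (cst : {rmorphism R -> P}).
Variables (x y : P) (u : nat -> nat -> P) (dx dy : P -> P).
Hypothesis J : jets cst x y u dx dy.
Variable ev : {rmorphism F -> P}.
Hypothesis ev_cst : forall a, ev (c a) = cst a.
Hypothesis ev_i0 : ev i0 = u 0%N 0%N.
Hypothesis ev_i2c : ev i2c = u 1%N 0%N ^+ 2 * u 0%N 2%N
  - 2 * u 1%N 0%N * u 0%N 1%N * u 1%N 1%N + u 0%N 1%N ^+ 2 * u 2%N 0%N.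
Hypothesis ev_D1 : forall p, ev (D1 p) = x * dx (ev p) + y * dy (ev p).
Hypothesis ev_D2 : forall p,
  ev (D2 p) = u 1%N 0%N * dy (ev p) - u 0%N 1%N * dx (ev p).
Hypothesis Cdiv : forall p q, ev p <> 0 -> C (p * q) -> C q.
Hypothesis evC : forall p, C p -> ev p = 0.

Lemma ev_i1 : ev i1 = x * u 1%N 0%N + y * u 0%N 1%N.
Proof. by rewrite ev_D1 ev_i0 (jets_dx_u J) (jets_dy_u J). Qed.

Lemma ev_nsym v : ev (nsym v) = nval x y u dx dy v.
Proof.
case: v => [[t|[i j]]|j] //=.
  elim: j => [|j IHj] /=; last by rewrite ev_D2 IHj.
  by elim: i => [|i IHi] /=; [exact: ev_i1 | rewrite ev_D1 IHi].
by elim: j => [|j IHj] /=; last by rewrite ev_D2 IHj.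
Qed.

Lemma reducible_ev_eq0 r : L r -> ev r = 0 -> C r.
Proof.
move=> [n [N CN]] r0.
have evN M : ev (msubst c nsym M) = msubst cst (nval x y u dx dy) M.
  elim/mpol_ind: M => [a|v|M1 M2 E1 E2|M1 M2 E1 E2].
  - by rewrite !msubst_const ev_cst.
  - by rewrite !msubst_var ev_nsym.
  - by rewrite !rmorphD E1 E2.
  by rewrite !rmorphM E1 E2.
have N0 : N = 0.
  apply: (normal_independent J); rewrite -evN.
  have := evC CN; rewrite rmorphB rmorphM r0 mulr0 sub0r => /eqP.
  by rewrite oppr_eq0 => /eqP.
move: CN; rewrite N0 rmorph0 subr0; apply: Cdiv; apply/eqP.
by rewrite rmorphXn /= ev_i1 expf_neq0 // (i1_neq0 J).
Qed.

End Completeness.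

(** * Generators *)

Section Density.
Variables (R : realType) (K : fieldType) (kc : {rmorphism R -> K}).

Definition polyfun (f : K -> K) : Prop := exists p : {poly K}, forall t, f t = p.[t].

Lemma polyfun_cst a : polyfun (fun=> a).
Proof. by exists a%:P => t; rewrite hornerC. Qed.
Lemma polyfun_id : polyfun id.
Proof. by exists 'X => t; rewrite hornerX. Qed.
Lemma polyfunD f g : polyfun f -> polyfun g -> polyfun (fun t => f t + g t).
Proof. by move=> [p fp] [q gq]; exists (p + q) => t; rewrite hornerD fp gq. Qed.
Lemma polyfunM f g : polyfun f -> polyfun g -> polyfun (fun t => f t * g t).
Proof. by move=> [p fp] [q gq]; exists (p * q) => t; rewrite hornerM fp gq. Qed.
Lemma polyfunN f : polyfun f -> polyfun (fun t => - f t).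
Proof. by move=> [p fp]; exists (- p) => t; rewrite hornerN fp. Qed.

Lemma polyfun_eq0 f : polyfun f -> (forall r, f (kc r) = 0) -> forall t, f t = 0.
Proof.
move=> [p fp] f0 t; rewrite fp; suff -> : p = 0 by rewrite horner0.
apply/eqP; apply: contraT => p0.
pose rs := [seq kc n%:R | n <- iota 0 (size p)].
have := @max_poly_roots _ p rs p0; rewrite size_map size_iota ltnn; apply.
  by apply/allP => _ /mapP[n _ ->]; rewrite /root -fp f0.
rewrite map_inj_uniq ?iota_uniq // => m n /(fmorph_inj kc) /eqP.
by rewrite Num.Theory.eqr_nat => /eqP.
Qed.

(* Every element of SL(2, K) is a product of four unipotent triangular        *)
(* matrices, so that the real points are dense in it.                         *)
Lemma sl2_density (Phi : K -> K -> K -> K -> K) :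
  (forall p q r t, polyfun p -> polyfun q -> polyfun r -> polyfun t ->
     polyfun (fun z => Phi (p z) (q z) (r z) (t z))) ->
  (forall p q r t : R, p * t - r * q = 1 ->
     Phi (kc p) (kc q) (kc r) (kc t) = 0) ->
  forall p q r t, p * t - r * q = 1 -> Phi p q r t = 0.
Proof.
move=> Phi_poly Phi0.
(* The matrix with columns (p, q), (r, t) is written as lower(e) upper(a) lower(b) upper(c), each
   factor unipotent. *)
pose G e a b c := Phi (1 + a * b) (b + e * (1 + a * b)) (a + c + a * b * c)
  (1 + b * c + e * (a + c + a * b * c)).
have G_poly e a b c : polyfun e -> polyfun a -> polyfun b -> polyfun c ->
    polyfun (fun z => G (e z) (a z) (b z) (c z)).
  move=> pe pa pb pc.
  have p1 := polyfun_cst 1.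
  have pp := polyfunD p1 (polyfunM pa pb).
  have pr := polyfunD (polyfunD pa pc) (polyfunM (polyfunM pa pb) pc).
  apply: Phi_poly => //; first by apply: polyfunD => //; apply: polyfunM.
  by apply: polyfunD; [apply: polyfunD => //; apply: polyfunM|apply: polyfunM].
(* The four parameters are freed from the real numbers one at a time. *)
have G0 e a b c : G e a b c = 0.
  have pC := polyfun_cst; have pI := polyfun_id.
  move: c; apply: polyfun_eq0 => [|c]; first exact: G_poly.
  move: b; apply: polyfun_eq0 => [|b]; first exact: G_poly.
  move: a; apply: polyfun_eq0 => [|a]; first exact: G_poly.
  move: e; apply: polyfun_eq0 => [|e]; first exact: G_poly.
  rewrite /G -(rmorph1 kc) -!rmorphM -!rmorphD -!rmorphM -!rmorphD.
  by apply: Phi0; ring.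
move=> p q r t det1.
(* Removing lower(e) must leave a nonzero lower left entry [b]; [a] and [c] are then found by
   dividing by [b]. *)
have [e b0] : exists e, q - e * p != 0.
  have [q0|q0] := eqVneq q 0; last by exists 0; rewrite mul0r subr0.
  exists 1; rewrite q0 mul1r sub0r oppr_eq0.
  by apply: contra_eq_neq det1 => ->; rewrite q0 mul0r mulr0 subrr eq_sym oner_eq0.
set b := q - e * p in b0.
have rb : r * b = p * t - 1 - e * p * r by rewrite /b -det1; ring.
have qE : q = b + e * p by rewrite /b subrK.
have rE : r = (p * t - 1 - e * p * r) / b by rewrite -rb mulfK.
rewrite -(G0 e ((p - 1) / b) b ((t - e * r - 1) / b)) /G.
have <- : p = 1 + (p - 1) / b * b by rewrite mulfVK // addrC subrK.
rewrite -qE.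
have <- : r = (p - 1) / b + (t - e * r - 1) / b + (p - 1) / b * b * ((t - e * r - 1) / b).
  by rewrite {1}rE mulfVK //; ring.
by have <- : t = 1 + b * ((t - e * r - 1) / b) + e * r by rewrite [b * _]mulrC mulfVK //; ring.
Qed.

End Density.

(** * Contractions of the symmetric differentials of u *)

Section Contractions.
Variable K : fieldType.
Implicit Types (s : nat -> nat -> K).

(* A sequence s stands for a linear functional on the binary forms in two     *)
(* variables, and [lin p q s] for its composition with the multiplication by  *)
(* the linear form with coefficients (p, q).                                  *)
Definition lin (p q : K) s : nat -> nat -> K :=
  fun a b => p * s a.+1 b + q * s a b.+1.

Lemma linC p q r t s : lin p q (lin r t s) = lin r t (lin p q s).
Proof. by apply/funext => a; apply/funext => b; rewrite /lin; ring. Qed.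

Lemma iter_linC i p q r t s :
  iter i (lin p q) (lin r t s) = lin r t (iter i (lin p q) s).
Proof. by elim: i => //= i ->; rewrite linC. Qed.

Lemma iter_linD i p q s s' : iter i (lin p q) (fun a b => s a b + s' a b) =
  (fun a b => iter i (lin p q) s a b + iter i (lin p q) s' a b).
Proof.
by elim: i => //= i ->; apply/funext => a; apply/funext => b; rewrite /lin; ring.
Qed.

Lemma iter_linZ i p q k s : iter i (lin p q) (fun a b => k * s a b) =
  (fun a b => k * iter i (lin p q) s a b).
Proof.
by elim: i => //= i ->; apply/funext => a; apply/funext => b; rewrite /lin; ring.
Qed.

Lemma iter_lin0 i p q : iter i (lin p q) (fun _ _ => 0) = (fun _ _ => 0).
Proof.
by elim: i => //= i ->; apply/funext => a; apply/funext => b; rewrite /lin; ring.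
Qed.

End Contractions.

(** * Translates of the generic jet over the function field *)

Section Generation.
Variables (R : realType) (P : idomainType) (cst : {rmorphism R -> P}).
Variables (x y : P) (u : nat -> nat -> P) (dx dy : P -> P).
Hypothesis J : jets cst x y u dx dy.
Variables (K : fieldType) (iota : {rmorphism P -> K}).
Hypothesis iota_inj : injective iota.
Variables (Dx Dy : K -> K).
Hypotheses (dDx : derivation Dx) (dDy : derivation Dy).
Hypotheses (Dx_iota : forall p, Dx (iota p) = iota (dx p))
           (Dy_iota : forall p, Dy (iota p) = iota (dy p)).
Let ddx := jets_dx J.
Let ddy := jets_dy J.
Let dE := (derD ddx, derD ddy, derB ddx, derB ddy, derM ddx, derM ddy).
Let jE := (jets_dx_cst J, jets_dy_cst J, jets_dx_x J, jets_dx_y J, jets_dy_x J,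
  jets_dy_y J, jets_dx_u J, jets_dy_u J).
Let kc : {rmorphism R -> K} := iota \o cst.
Let us a b : K := iota (u a b).

Definition contract p q r t i j : K :=
  iter i (lin p q) (iter j (lin r t) us) 0%N 0%N.

Lemma point_exists p q r t : exists f : {rmorphism P -> K},
  [/\ forall a, f (cst a) = kc a,
      f x = t * iota x - r * iota y, f y = p * iota y - q * iota x &
      forall i j, f (u i j) = contract p q r t i j].
Proof. exact: (jets_sub J). Qed.

(* For h with columns (p, q) and (r, t) of determinant 1, the translate by    *)
(* h^-1 of the generic jet.                                                   *)
Definition point p q r t : {rmorphism P -> K} := projT1 (cid (point_exists p q r t)).

Lemma pointP p q r t :
  [/\ forall a, point p q r t (cst a) = kc a,
      point p q r t x = t * iota x - r * iota y,
      point p q r t y = p * iota y - q * iota x &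
      forall i j, point p q r t (u i j) = contract p q r t i j].
Proof. exact: projT2 (cid (point_exists p q r t)). Qed.

Lemma point_polyfun (p q r t : K -> K) m :
  polyfun p -> polyfun q -> polyfun r -> polyfun t ->
  polyfun (fun z => point (p z) (q z) (r z) (t z) m).
Proof.
move=> pp pq pr pt.
have ext (f g : K -> K) : f =1 g -> polyfun g -> polyfun f.
  by move=> fg [h gh]; exists h => z; rewrite fg gh.
have cst_poly a : polyfun (fun=> a : K) by apply: polyfun_cst.
elim/(jets_ind J): m => [a|||i j|m n Em En|m n Em En].
- by apply: ext (cst_poly (kc a)) => z; have [-> _ _ _] := pointP (p z) (q z) (r z) (t z).
- apply: (ext _ (fun z => t z * iota x + r z * (- iota y))) => [z|].
    by have [_ -> _ _] := pointP (p z) (q z) (r z) (t z); rewrite mulrN.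
  by apply: polyfunD; apply: polyfunM.
- apply: (ext _ (fun z => p z * iota y + q z * (- iota x))) => [z|].
    by have [_ _ -> _] := pointP (p z) (q z) (r z) (t z); rewrite mulrN.
  by apply: polyfunD; apply: polyfunM.
- apply: (ext _ (fun z => contract (p z) (q z) (r z) (t z) i j)) => [z|].
    by have [_ _ _ ->] := pointP (p z) (q z) (r z) (t z).
  have lin_poly (v w : K -> K) (s : K -> nat -> nat -> K) k :
      polyfun v -> polyfun w -> (forall a b, polyfun (fun z => s z a b)) ->
      forall a b, polyfun (fun z => iter k (lin (v z) (w z)) (s z) a b).
    move=> pv pw ps; elim: k => //= k IHk a b.
    by apply: polyfunD; apply: polyfunM.
  have rt_poly := lin_poly r t (fun=> us) j pr pt (fun a b => cst_poly (us a b)).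
  exact: (lin_poly p q (fun z => iter j (lin (r z) (t z)) us) i pp pq rt_poly).
- by apply: ext (polyfunD Em En) => z; rewrite rmorphD.
by apply: ext (polyfunM Em En) => z; rewrite rmorphM.
Qed.

Lemma point_id m : point 1 0 0 1 m = iota m.
Proof.
have [pc px py pu] := pointP 1 0 0 1.
elim/(jets_ind J): m => [a|||i j|m n Em En|m n Em En].
- by rewrite pc.
- by rewrite px mul1r mul0r subr0.
- by rewrite py mul1r mul0r subr0.
- rewrite pu /contract.
  have lin1 k s a b : iter k (lin (1 : K) 0) s a b = s (k + a)%N b.
    by elim: k a => //= k IHk a; rewrite /lin IHk mul1r mul0r addr0 addnS.
  have lin2 k s a b : iter k (lin (0 : K) 1) s a b = s a (k + b)%N.
    by elim: k b => //= k IHk b; rewrite /lin IHk mul1r mul0r add0r addnS.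
  by rewrite lin1 lin2 !addn0.
- by rewrite !rmorphD Em En.
by rewrite !rmorphM Em En.
Qed.

Lemma point_prolong (p q r t : R) (f : {rmorphism P -> P}) :
  is_prolongation cst x y u dx dy t (- r) (- q) p f ->
  forall m, iota (f m) = point (kc p) (kc q) (kc r) (kc t) m.
Proof.
move=> [fc fx fy fu] m; have [pc px py pu] := pointP (kc p) (kc q) (kc r) (kc t).
elim/(jets_ind J): m => [a|||i j|m n Em En|m n Em En].
- by rewrite fc pc.
- by rewrite fx px rmorphN mulNr rmorphB !rmorphM.
- by rewrite fy py rmorphN mulNr addrC rmorphB !rmorphM.
- rewrite fu pu /contract.
  (* On such families the total derivatives are index shifts. Combinations with constant
     coefficients preserve this, so iterated prolonged derivatives become iterates of [lin]. *)
  pose good (X : nat -> nat -> P) := forall a b,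
    dx (X a b) = X a.+1 b /\ dy (X a b) = X a b.+1.
  pose px' := prolong_dx cst dx dy (- q) p.
  pose py' := prolong_dy cst dx dy t (- r).
  have step k l (X : nat -> nat -> P) : good X ->
      good (fun a b => cst k * X a.+1 b + cst l * X a b.+1).
    move=> gX a b; have g1 c d := proj1 (gX c d); have g2 c d := proj2 (gX c d).
    by rewrite !dE !jE !g1 !g2 !mul0r !add0r.
  have pxE (X : nat -> nat -> P) : good X ->
      (fun a b => px' (X a b)) = (fun a b => cst p * X a.+1 b + cst q * X a b.+1).
    move=> gX; apply/funext => a; apply/funext => b; have [gx gy] := gX a b.
    by rewrite /px' /prolong_dx gx gy rmorphN mulNr opprK.
  have pyE (X : nat -> nat -> P) : good X ->
      (fun a b => py' (X a b)) = (fun a b => cst r * X a.+1 b + cst t * X a b.+1).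
    move=> gX; apply/funext => a; apply/funext => b; have [gx gy] := gX a b.
    by rewrite /py' /prolong_dy gx gy rmorphN mulNr opprK addrC.
  have Y k : good (fun a b => iter k py' (u a b)) /\
      (fun a b => iota (iter k py' (u a b))) = iter k (lin (kc r) (kc t)) us.
    elim: k => [|k [gY YE]]; first by split=> // a b; rewrite !jE.
    have E := pyE _ gY; rewrite iterS -YE; split.
      by rewrite -[X in good X]/(fun a b => py' (iter k py' (u a b))) E; exact: (step r t _ gY).
    apply/funext => a; apply/funext => b.
    have /(congr1 (fun g => g a b)) /= -> := E.
    by rewrite /lin rmorphD !rmorphM.
  have X k : good (fun a b => iter k px' (iter j py' (u a b))) /\
      (fun a b => iota (iter k px' (iter j py' (u a b)))) =
      iter k (lin (kc p) (kc q)) (iter j (lin (kc r) (kc t)) us).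
    elim: k => [|k [gX XE]]; first by have [gY YE] := Y j; split.
    have E := pxE _ gX; rewrite iterS -XE; split.
      rewrite -[Z in good Z]/(fun a b => px' (iter k px' (iter j py' (u a b)))) E.
      exact: (step p q _ gX).
    apply/funext => a; apply/funext => b.
    have /(congr1 (fun g => g a b)) /= -> := E.
    by rewrite /lin rmorphD !rmorphM.
  by have [_ /(congr1 (fun g => g 0%N 0%N))] := X i.
- by rewrite !rmorphD Em En.
by rewrite !rmorphM Em En.
Qed.


(** * The moving frame and a subfield closed under \nabla_1, \nabla_2 *)

Variable FF : K -> Prop.
Hypotheses (FFc : forall r, FF (kc r)) (FFD : forall p q, FF p -> FF q -> FF (p + q)).
Hypotheses (FFM : forall p q, FF p -> FF q -> FF (p * q)).
Hypotheses (FFV : forall p, FF p -> FF p^-1).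
Local Notation X := (iota x).
Local Notation Y := (iota y).
Local Notation Ux := (us 1%N 0%N).
Local Notation Uy := (us 0%N 1%N).
Local Notation Uxx := (us 2%N 0%N).
Local Notation Uxy := (us 1%N 1%N).
Local Notation Uyy := (us 0%N 2%N).
Let N1 q := X * Dx q + Y * Dy q.
Let N2 q := Ux * Dy q - Uy * Dx q.
Let I1 := X * Ux + Y * Uy.
Let I2a := X ^+ 2 * Uxx + 2 * X * Y * Uxy + Y ^+ 2 * Uyy.
Let I2b := X * Uy * Uxx - Y * Ux * Uyy + (Y * Uy - X * Ux) * Uxy.
Let I2c := Ux ^+ 2 * Uyy - 2 * Ux * Uy * Uxy + Uy ^+ 2 * Uxx.
Hypotheses (FFN1 : forall q, FF q -> FF (N1 q)) (FFN2 : forall q, FF q -> FF (N2 q)).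
Hypotheses (FFu : FF (us 0%N 0%N)) (FF1 : FF I1) (FFa : FF I2a) (FFb : FF I2b)
  (FF2c : FF I2c).

Let I1n0 : I1 != 0.
Proof.
by rewrite /I1 -!rmorphM -rmorphD (raddf_eq0 _ iota_inj) (i1_neq0 J).
Qed.

Lemma FF_zero : FF 0. Proof. by rewrite -(rmorph0 kc). Qed.
Lemma FF_one : FF 1. Proof. by rewrite -(rmorph1 kc). Qed.
Lemma FFN p : FF p -> FF (- p).
Proof. by move=> Fp; rewrite -mulN1r -(rmorph1 kc) -rmorphN; apply: FFM. Qed.
Lemma FFB p q : FF p -> FF q -> FF (p - q).
Proof. by move=> Fp Fq; apply: FFD => //; apply: FFN. Qed.

Let lA := lin X Y.
Let lB := lin (- Uy) Ux.

(* The contractions T_ij with A = (x, y) and B = (- u_y, u_x).                 *)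
Definition frame_coord i j := iter i lA (iter j lB us) 0%N 0%N.

Definition FF_order n := forall i j, (i + j)%N = n -> FF (frame_coord i j).

(** Models the combinations, with coefficients in [FF], of the contractions of [us] with [n] copies
    of A or B: completed by further copies, they lie in [FF] as soon as the T_ij of the total order
    do. *)
Definition frame_span n (s : nat -> nat -> K) : Prop :=
  forall a b, FF_order (n + a + b) -> FF (iter a lA (iter b lB s) 0%N 0%N).

Lemma frame_span_A n s : frame_span n s -> frame_span n.+1 (lA s).
Proof.
move=> sn a b; rewrite addSnnS => /sn.
by rewrite iterSr /lA /lB (iter_linC b).
Qed.

Lemma frame_span_B n s : frame_span n s -> frame_span n.+1 (lB s).
Proof. by move=> sn a b; rewrite !addSn -addnS => /sn; rewrite iterSr. Qed.

Lemma frame_span_D n s s' : frame_span n s -> frame_span n s' ->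
  frame_span n (fun a b => s a b + s' a b).
Proof.
by move=> sn sn' a b Qn; rewrite /lA /lB !iter_linD; apply: FFD; [apply: sn|apply: sn'].
Qed.

Lemma frame_span_Z n k s : FF k -> frame_span n s -> frame_span n (fun a b => k * s a b).
Proof.
by move=> Fk sn a b Qn; rewrite /lA /lB !iter_linZ; apply: FFM => //; apply: sn.
Qed.

Lemma frame_span_lin n p q v w s : FF v -> FF w ->
  p = v * X + w * - Uy -> q = v * Y + w * Ux ->
  frame_span n s -> frame_span n.+1 (lin p q s).
Proof.
move=> Fv Fw -> -> sn.
have -> : lin (v * X + w * - Uy) (v * Y + w * Ux) s =
    (fun a b => v * lA s a b + w * lB s a b).
  by apply/funext => a; apply/funext => b; rewrite /lin /lA /lB /lin; ring.
by apply: frame_span_D; apply: frame_span_Z => //;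
  [apply: frame_span_A|apply: frame_span_B].
Qed.

Lemma frame_span_us : frame_span 0 us.
Proof. by move=> a b; apply. Qed.

(** [D] contracts the jet once more with (v, w) and maps each of A and B to a combination of A and B
    over [FF]. *)
Definition frame_der (D : K -> K) (v w : K) : Prop :=
  [/\ derivation D, forall a b, D (us a b) = lin v w us a b,
      exists k l, [/\ FF k, FF l, D X = k * X + l * - Uy & D Y = k * Y + l * Ux] &
      exists k l, [/\ FF k, FF l, D (- Uy) = k * X + l * - Uy & D Ux = k * Y + l * Ux]].

(** By Leibniz, [D] applied to T_ij is the contraction with one more vector (v, w), plus terms [s']
    where [D] hits a copy of A or B; the latter have order i + j and lie in [FF]. *)
Lemma frame_der_coord D v w i j : frame_der D v w -> FF_order (i + j) ->
  FF (D (frame_coord i j)) ->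
  FF (lin v w (iter i lA (iter j lB us)) 0%N 0%N).
Proof.
move=> [dD Dus [k [l [Fk Fl DX DY]]] [k' [l' [Fk' Fl' DUy DUx]]]] Qn FD.
pose rel s s' := forall a b, D (s a b) = lin v w s a b + s' a b.
have rel_lin p q s s' : rel s s' -> rel (lin p q s)
    (fun a b => lin (D p) (D q) s a b + lin p q s' a b).
  move=> r a b; rewrite {1}/lin (derD dD) !(derM dD) !r /lin; ring.
suff [s' rs' ss'] : exists2 s', rel (iter i lA (iter j lB us)) s' & frame_span (i + j) s'.
  move: FD; rewrite /frame_coord rs' => FD.
  have Fs' : FF (s' 0%N 0%N) by apply: (ss' 0%N 0%N); rewrite !addn0.
  by have := FFB FD Fs'; rewrite addrK.
have sus n m : frame_span (n + m) (iter n lA (iter m lB us)).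
  elim: n => [|n IHn]; last exact: frame_span_A.
  by elim: m => [|m IHm]; [exact: frame_span_us|exact: frame_span_B].
have sD n s p q k1 l1 : FF k1 -> FF l1 -> D p = k1 * X + l1 * - Uy ->
    D q = k1 * Y + l1 * Ux -> frame_span n s -> frame_span n.+1 (lin (D p) (D q) s).
  by move=> F1 F2 Dp Dq; apply: frame_span_lin Dp Dq.
elim: i {Qn FD} => [|i [s' rs' ss']].
  elim: j => [|j [s' rs' ss']].
    exists (fun _ _ => 0); first by move=> a b; rewrite Dus addr0.
    by move=> a b _; rewrite /lA /lB !iter_lin0; apply: FF_zero.
  exists (fun a b => lin (D (- Uy)) (D Ux) (iter j lB us) a b + lB s' a b).
    exact: rel_lin.
  apply: frame_span_D; last exact: frame_span_B.
  by apply: sD DUy DUx _ => //; apply: (sus 0%N).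
exists (fun a b => lin (D X) (D Y) (iter i lA (iter j lB us)) a b + lA s' a b).
  exact: rel_lin.
apply: frame_span_D; last exact: frame_span_A.
by apply: sD DX DY _ => //; apply: sus.
Qed.

Let iE := (Dx_iota, Dy_iota, jets_dx_x J, jets_dx_y J, jets_dy_x J,
  jets_dy_y J, jets_dx_u J, jets_dy_u J, rmorph1 iota, rmorph0 iota).

(** \nabla_1 A = A and \nabla_1 B = (I2b / I1) A + (I2a / I1) B. *)
Lemma frame_der_N1 : frame_der N1 X Y.
Proof.
split; first exact: der_comb.
- by move=> a b; rewrite /N1 /us !iE.
- exists 1, 0; split; [exact: FF_one|exact: FF_zero|..]; rewrite /N1 !iE; ring.
exists (I2b / I1), (I2a / I1).
by split; [exact: FFM FFb (FFV FF1)|exact: FFM FFa (FFV FF1)|..];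
  rewrite /N1 ?(derN dDx, derN dDy) /I2a /I2b /I1 /us !iE; field; exact: I1n0.
Qed.

(** \nabla_2 A = B and \nabla_2 B = - (I2c / I1) A - (I2b / I1) B. *)
Lemma frame_der_N2 : frame_der N2 (- Uy) Ux.
Proof.
split.
- exact: der_combB.
- by move=> a b; rewrite /N2 /us !iE /lin /us; ring.
- exists 0, 1; split; [exact: FF_zero|exact: FF_one|..]; rewrite /N2 /us !iE; ring.
exists (- (I2c / I1)), (- (I2b / I1)).
by split; [exact/FFN/(FFM FF2c (FFV FF1))|exact/FFN/(FFM FFb (FFV FF1))|..];
  rewrite /N2 ?(derN dDx, derN dDy) /I2c /I2b /I1 /us !iE; field; exact: I1n0.
Qed.

(** T_(i+1)j comes from \nabla_1 T_ij, and T_0(n+1) from \nabla_2 T_0n. *)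
Lemma FF_frame_coord n : FF_order n.
Proof.
elim: n => [|n IHn] i j; first by move/eqP; rewrite addn_eq0 => /andP[/eqP-> /eqP->].
case: i => [|i]; last first.
  rewrite addSn => -[ij]; have Fij := IHn i j ij.
  by apply: (frame_der_coord frame_der_N1); rewrite ?ij //; apply: FFN1.
rewrite add0n => ->; have Fn := IHn 0%N n (add0n n).
by apply: (frame_der_coord (i := 0%N) frame_der_N2) => //; apply: FFN2.
Qed.

(* The generic jet moved by the moving frame and then by k^-1, for k with      *)
(* columns (p, q) and (r, t).                                                 *)
Definition framed (p q r t : K) : {rmorphism P -> K} :=
  point (p * X + q / I1 * - Uy) (p * Y + q / I1 * Ux)
        (r * X + t / I1 * - Uy) (r * Y + t / I1 * Ux).

Lemma framed_det p q r t : p * t - r * q = 1 ->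
  (p * X + q / I1 * - Uy) * (r * Y + t / I1 * Ux) -
  (r * X + t / I1 * - Uy) * (p * Y + q / I1 * Ux) = 1.
Proof. by move=> <-; rewrite /I1; field; exact: I1n0. Qed.

(** The frame carries the base point to (1, 0), hence the framed jet lies over (t, - q); its
    derivatives are contractions with combinations of A and B over [FF]. *)
Lemma FF_framed p q r t m : p * t - r * q = 1 -> FF p -> FF q -> FF r -> FF t ->
  FF (framed p q r t m).
Proof.
move=> det1 Fp Fq Fr Ft; rewrite /framed; set a := _ + _; set b := _ + _.
set c := (X in point _ _ X _); set d := (X in point _ _ _ X).
have [pc px py pu] := pointP a b c d.
elim/(jets_ind J): m => [e|||i j|m n Em En|m n Em En].
- by rewrite pc.
- have -> : point a b c d x = t.
    by rewrite px /c /d /I1; field; exact: I1n0.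
  exact: Ft.
- have -> : point a b c d y = - q.
    by rewrite py /a /b /I1; field; exact: I1n0.
  exact: FFN.
- rewrite pu /contract.
  have Fq1 : FF (q / I1) by apply: FFM => //; apply: FFV.
  have Ft1 : FF (t / I1) by apply: FFM => //; apply: FFV.
  suff : frame_span (i + j) (iter i (lin a b) (iter j (lin c d) us)).
    by move=> /(_ 0%N 0%N); apply; apply: FF_frame_coord.
  elim: i => [|i IHi]; last exact: frame_span_lin Fp Fq1 _ _ IHi.
  elim: j => [|j IHj]; first exact: frame_span_us.
  exact: frame_span_lin Fr Ft1 _ _ IHj.
- by rewrite rmorphD; apply: FFD.
by rewrite rmorphM; apply: FFM.
Qed.

Lemma framed_polyfun (p q r t : K -> K) m :
  polyfun p -> polyfun q -> polyfun r -> polyfun t ->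
  polyfun (fun z => framed (p z) (q z) (r z) (t z) m).
Proof.
move=> pp pq pr pt; have pC (k : K) := polyfun_cst k.
have entry (f g : K -> K) (v w : K) : polyfun f -> polyfun g ->
    polyfun (fun z => f z * v + g z / I1 * w).
  by move=> pf pg; apply: polyfunD; apply: polyfunM => //; apply: polyfunM.
by apply: point_polyfun; apply: entry.
Qed.

Lemma invariant_generated n d : d != 0 ->
  (forall a b c e (f : {rmorphism P -> P}), a * e - b * c = 1 ->
     is_prolongation cst x y u dx dy a b c e f -> f n * d = n * f d) ->
  FF (iota n / iota d).
Proof.
move=> d0 inv.
have pcst (g h k l : K -> K) m : polyfun g -> polyfun h -> polyfun k -> polyfun l ->
    polyfun (fun z => point (g z) (h z) (k z) (l z) m) by move=> *; apply: point_polyfun.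
(* Cleared of denominators, invariance is polynomial in the matrix entries and extends to SL(2,
   K). *)
have invK p q r t : p * t - r * q = 1 ->
    point p q r t n * iota d - iota n * point p q r t d = 0.
  move: p q r t; apply: (sl2_density (kc := kc)) => [p q r t pp pq pr pt|p q r t det1].
    have pC (k : K) := polyfun_cst k.
    apply: polyfunD; first by apply: polyfunM => //; apply: pcst.
    by apply: polyfunN; apply: polyfunM => //; apply: pcst.
  have [f pf] := prolong_exists J t (- r) (- q) p.
  rewrite -!(point_prolong pf) -!rmorphM (inv _ _ _ _ _ _ pf) ?subrr //.
  by rewrite -det1; ring.
(* A real matrix keeping the denominator nonzero at the framed jet. If there were none, density
   would make [d] vanish also for the inverse of the frame, where the framed jet is the generic
   one. *)
have [p [q [r [t [det1 dn0]]]]] : exists p q r t : R,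
    p * t - r * q = 1 /\ framed (kc p) (kc q) (kc r) (kc t) d != 0.
  apply/not_existsP => no.
  have d0K p q r t : p * t - r * q = 1 -> framed p q r t d = 0.
    move: p q r t; apply: (sl2_density (kc := kc)) => [p q r t *|p q r t det1].
      exact: framed_polyfun.
    by apply/eqP; apply: contraT => dn0; case: (no p); exists q, r, t.
  have : framed (Ux / I1) (- Y) (Uy / I1) X d = 0.
    by apply: d0K; rewrite /I1; field; exact: I1n0.
  rewrite /framed.
  have -> : Ux / I1 * X + - Y / I1 * - Uy = 1 by rewrite /I1; field; exact: I1n0.
  have -> : Ux / I1 * Y + - Y / I1 * Ux = 0 by ring.
  have -> : Uy / I1 * X + X / I1 * - Uy = 0 by ring.
  have -> : Uy / I1 * Y + X / I1 * Ux = 1 by rewrite /I1; field; exact: I1n0.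
  by rewrite point_id => /eqP; rewrite (raddf_eq0 _ iota_inj) (negPf d0).
have detK : kc p * kc t - kc r * kc q = 1 by rewrite -!rmorphM -rmorphB det1 rmorph1.
have /eqP := invK _ _ _ _ (framed_det detK).
rewrite subr_eq0 -/(framed _ _ _ _) => /eqP E.
have -> : iota n / iota d = framed (kc p) (kc q) (kc r) (kc t) n /
    framed (kc p) (kc q) (kc r) (kc t) d.
  by apply/eqP; rewrite eqr_div ?(raddf_eq0 _ iota_inj) // -E mulrC.
by apply: FFM; [|apply: FFV]; apply: FF_framed.
Qed.

End Generation.

(** * Invariance of the derivations and generators *)

Section JetFunctionField.
Variables (R : realType) (P : idomainType) (cst : {rmorphism R -> P}).
Variables (x y : P) (u : nat -> nat -> P) (dx dy : P -> P).
Hypothesis J : jets cst x y u dx dy.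
Local Notation K := {fraction P}.
Local Notation "a %:F" := (@tofrac P a).
Local Notation Dx := (frac_der dx).
Local Notation Dy := (frac_der dy).
Local Notation X := (x%:F).
Local Notation Y := (y%:F).
Local Notation Ux := ((u 1%N 0%N)%:F).
Local Notation Uy := ((u 0%N 1%N)%:F).
Local Notation Uxx := ((u 2%N 0%N)%:F).
Local Notation Uxy := ((u 1%N 1%N)%:F).
Local Notation Uyy := ((u 0%N 2%N)%:F).
Local Notation N1 := (fun q => X * Dx q + Y * Dy q).
Local Notation N2 := (fun q => Ux * Dy q - Uy * Dx q).
Local Notation I1 := (X * Ux + Y * Uy).
Local Notation I2a := (X ^+ 2 * Uxx + 2 * X * Y * Uxy + Y ^+ 2 * Uyy).
Local Notation I2b := (X * Uy * Uxx - Y * Ux * Uyy + (Y * Uy - X * Ux) * Uxy).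
Local Notation I2c := (Ux ^+ 2 * Uyy - 2 * Ux * Uy * Uxy + Uy ^+ 2 * Uxx).
Let u0 := (u 0%N 0%N)%:F.
Let ddx := jets_dx J.
Let ddy := jets_dy J.
Let dDx := jets_Dx J.
Let dDy := jets_Dy J.

Let DxE p : Dx p%:F = (dx p)%:F := jets_Dx_tofrac J p.
Let DyE p : Dy p%:F = (dy p)%:F := jets_Dy_tofrac J p.
Let DX : Dx X = 1. Proof. by rewrite DxE (jets_dx_x J) tofrac1. Qed.
Let DY : Dx Y = 0. Proof. by rewrite DxE (jets_dx_y J) tofrac0. Qed.
Let DX' : Dy X = 0. Proof. by rewrite DyE (jets_dy_x J) tofrac0. Qed.
Let DY' : Dy Y = 1. Proof. by rewrite DyE (jets_dy_y J) tofrac1. Qed.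
Let Dxu i j : Dx (u i j)%:F = (u i.+1 j)%:F. Proof. by rewrite DxE (jets_dx_u J). Qed.
Let Dyu i j : Dy (u i j)%:F = (u i j.+1)%:F. Proof. by rewrite DyE (jets_dy_u J). Qed.

Lemma N1_tofrac p : N1 p%:F = (x * dx p + y * dy p)%:F.
Proof. by rewrite tofracD !tofracM DxE DyE. Qed.

Lemma N2_tofrac p : N2 p%:F = (u 1%N 0%N * dy p - u 0%N 1%N * dx p)%:F.
Proof. by rewrite tofracB !tofracM DxE DyE. Qed.

Lemma I1E : I1 = N1 u0.
Proof. by rewrite /u0 Dxu Dyu. Qed.

Lemma I2aE : I2a = N1 (N1 u0) - N1 u0.
Proof.
have := nabla11_u u0 dDx dDy (jets_DC J) DX DY DX' DY'.
by rewrite /u0 Dxu Dyu Dxu Dxu Dyu.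
Qed.

Lemma I2bE : I2b = - N2 (N1 u0).
Proof.
have := nabla21_u u0 dDx dDy (jets_DC J) DX DY DX' DY'.
by rewrite /u0 Dxu Dyu Dxu Dxu Dyu.
Qed.

Lemma N_commutator q :
  I1 * (N1 (N2 q) - N2 (N1 q)) - I2b * N1 q - (I2a - I1) * N2 q = 0.
Proof.
have := nabla_commutator u0 dDx dDy (jets_DC J) DX DY DX' DY' q.
by rewrite /u0 Dxu Dyu Dxu Dxu Dyu.
Qed.

Lemma I2cE : I2c = (u 1%N 0%N ^+ 2 * u 0%N 2%N -
  2 * u 1%N 0%N * u 0%N 1%N * u 1%N 1%N + u 0%N 1%N ^+ 2 * u 2%N 0%N)%:F.
Proof. by rewrite tofracD tofracB !tofracM rmorph_nat. Qed.

Section Action.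
Variables (a b c d : R) (f : {rmorphism P -> P}) (F : {rmorphism K -> K}).
Hypotheses (det1 : a * d - b * c = 1) (pf : is_prolongation cst x y u dx dy a b c d f).
Hypothesis FE : frac_map f = F.

Let cdet : cst a * cst d - cst b * cst c = 1.
Proof. by rewrite -!rmorphM -rmorphB det1 rmorph1. Qed.
Let Cdet : (cst a)%:F * (cst d)%:F - (cst b)%:F * (cst c)%:F = 1.
Proof. by rewrite -!tofracM -tofracB cdet tofrac1. Qed.

Let Fp p : F p%:F = (f p)%:F.
Proof. by rewrite -FE frac_map_tofrac //; exact: (prolong_inj J det1 pf). Qed.

Let fux : f (u 1%N 0%N) = cst d * u 1%N 0%N - cst c * u 0%N 1%N.
Proof.
by have [_ _ _ ->] := pf; rewrite /= /prolong_dx (jets_dx_u J) (jets_dy_u J).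
Qed.
Let fuy : f (u 0%N 1%N) = cst a * u 0%N 1%N - cst b * u 1%N 0%N.
Proof.
by have [_ _ _ ->] := pf; rewrite /= /prolong_dy (jets_dx_u J) (jets_dy_u J).
Qed.

Lemma prolong_u0 : F u0 = u0.
Proof. by rewrite Fp; have [_ _ _ ->] := pf. Qed.

Lemma prolong_N1 q : F (N1 q) = N1 (F q).
Proof.
have [FDx FDy] := prolong_frac J det1 pf FE q; have [_ fx fy _] := pf.
rewrite rmorphD (rmorphM F X) (rmorphM F Y) FDx FDy !Fp fx fy !tofracD !tofracM.
have E (L : comPzRingType) (a' b' c' d' X' Y' v w : L) : a' * d' - b' * c' = 1 ->
    (a' * X' + b' * Y') * (d' * v - c' * w) + (c' * X' + d' * Y') * (a' * w - b' * v) =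
    X' * v + Y' * w.
  by move=> e; rewrite -[RHS]mul1r -e; ring.
exact: E Cdet.
Qed.

Lemma prolong_N2 q : F (N2 q) = N2 (F q).
Proof.
have [FDx FDy] := prolong_frac J det1 pf FE q.
rewrite rmorphB (rmorphM F Ux) (rmorphM F Uy) FDx FDy !Fp fux fuy !tofracB !tofracM.
have E (L : comPzRingType) (a' b' c' d' X' Y' v w : L) : a' * d' - b' * c' = 1 ->
    (d' * X' - c' * Y') * (a' * w - b' * v) - (a' * Y' - b' * X') * (d' * v - c' * w) =
    X' * w - Y' * v.
  by move=> e; rewrite -[RHS]mul1r -e; ring.
exact: E Cdet.
Qed.

Lemma prolong_I2c : F I2c = I2c.
Proof.
have [fc _ _ fu] := pf.
have dE := (derB ddx, derB ddy, derM ddx, derM ddy, jets_dx_cst J, jets_dy_cst J,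
  jets_dx_u J, jets_dy_u J).
(* As a polynomial identity, I2c is multiplied by the square of the determinant. *)
have det2 : (cst a * cst d - cst b * cst c) ^+ 2 = 1 by rewrite cdet expr1n.
have E : f (u 1%N 0%N ^+ 2 * u 0%N 2%N - 2 * u 1%N 0%N * u 0%N 1%N * u 1%N 1%N +
      u 0%N 1%N ^+ 2 * u 2%N 0%N) =
    u 1%N 0%N ^+ 2 * u 0%N 2%N - 2 * u 1%N 0%N * u 0%N 1%N * u 1%N 1%N +
      u 0%N 1%N ^+ 2 * u 2%N 0%N.
  rewrite rmorphD rmorphB !rmorphM rmorph_nat fux fuy !fu /=.
  rewrite /prolong_dx /prolong_dy !dE -[RHS]mul1r -[X in _ = X * _]det2; ring.
by rewrite I2cE Fp E.
Qed.

End Action.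

(** * The presentation for an abstract ring of formal expressions *)

Section Presentation.
Variables (F : comNzRingType) (c : {rmorphism R -> F}).
Variables (D1 D2 : F -> F) (i0 i2c : F).
Hypothesis F_ind : forall Q : F -> Prop, (forall a, Q (c a)) -> Q i0 -> Q i2c ->
  (forall p q, Q p -> Q q -> Q (p + q)) -> (forall p q, Q p -> Q q -> Q (p * q)) ->
  (forall p, Q p -> Q (D1 p)) -> (forall p, Q p -> Q (D2 p)) -> forall p, Q p.
Variable ev : {rmorphism F -> P}.
Hypothesis ev_cst : forall a, ev (c a) = cst a.
Hypothesis ev_i0 : ev i0 = u 0%N 0%N.
Hypothesis ev_i2c : ev i2c = u 1%N 0%N ^+ 2 * u 0%N 2%N
  - 2 * u 1%N 0%N * u 0%N 1%N * u 1%N 1%N + u 0%N 1%N ^+ 2 * u 2%N 0%N.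
Hypothesis ev_D1 : forall p, ev (D1 p) = x * dx (ev p) + y * dy (ev p).
Hypothesis ev_D2 : forall p,
  ev (D2 p) = u 1%N 0%N * dy (ev p) - u 0%N 1%N * dx (ev p).
Variable evK : F -> K.
Hypothesis evKE : forall p, evK p = (ev p)%:F.

Let i1 := D1 i0.
Let i2a := D1 i1 - i1.
Let i2b := - D2 i1.

Let dEx := (jets_dx_u J, jets_dy_u J).

Let ev_i1 : ev i1 = x * u 1%N 0%N + y * u 0%N 1%N.
Proof. by rewrite ev_D1 ev_i0 !dEx. Qed.

Let ev_i2a : ev i2a = x ^+ 2 * u 2%N 0%N + 2 * x * y * u 1%N 1%N + y ^+ 2 * u 0%N 2%N.
Proof.
have := nabla11_u (u 0%N 0%N) ddx ddy (jets_dC J) (jets_dx_x J) (jets_dx_y J) (jets_dy_x J)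
  (jets_dy_y J).
by rewrite rmorphB ev_D1 !ev_i1 !dEx => ->.
Qed.

Let ev_i2b : ev i2b = x * u 0%N 1%N * u 2%N 0%N - y * u 1%N 0%N * u 0%N 2%N +
  (y * u 0%N 1%N - x * u 1%N 0%N) * u 1%N 1%N.
Proof.
have := nabla21_u (u 0%N 0%N) ddx ddy (jets_dC J) (jets_dx_x J) (jets_dx_y J) (jets_dy_x J)
  (jets_dy_y J).
by rewrite rmorphN ev_D2 !ev_i1 !dEx => ->.
Qed.

Lemma ev_R1 : ev (D2 i0) = 0.
Proof. by rewrite ev_D2 ev_i0 !dEx mulrC subrr. Qed.

Lemma ev_R2 p : ev (i1 * (D1 (D2 p) - D2 (D1 p)) - i2b * D1 p - (i2a - i1) * D2 p) = 0.
Proof.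
have := nabla_commutator (u 0%N 0%N) ddx ddy (jets_dC J) (jets_dx_x J) (jets_dx_y J) (jets_dy_x J)
  (jets_dy_y J) (ev p).
move: (i2b) (i2a) (i1) ev_i2b ev_i2a ev_i1 => jb ja j1 eb ea e1.
rewrite !dEx !rmorphB !rmorphM !rmorphB e1 ea eb.
by rewrite [ev (D1 (D2 p))]ev_D1 [ev (D2 (D1 p))]ev_D2 ev_D1 ev_D2.
Qed.

Lemma ev_R3 :
  ev (i1 * D2 i2b + i1 * D1 i2c - (3 * i2a - i1) * i2c + 3 * i2b ^+ 2) = 0.
Proof.
have := nabla_syzygy (u 0%N 0%N) ddx ddy (jets_dC J) (jets_dx_x J) (jets_dx_y J) (jets_dy_x J)
  (jets_dy_y J).
move: (i2b) (i2a) (i1) ev_i2b ev_i2a ev_i1 => jb ja j1 eb ea e1.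
rewrite !dEx rmorphD rmorphB rmorphD !rmorphM rmorphB !rmorphM rmorph_nat.
by rewrite ev_D2 ev_D1 e1 ea eb ev_i2c.
Qed.

Lemma presentation_relations (C : F -> Prop) :
  derivation D1 -> derivation D2 ->
  (forall a, D1 (c a) = 0) -> (forall a, D2 (c a) = 0) ->
  C 0 -> (forall p q, C p -> C q -> C (p + q)) -> (forall p q, C q -> C (p * q)) ->
  (forall p, C p -> C (D1 p)) -> (forall p, C p -> C (D2 p)) ->
  C (D2 i0) ->
  (forall p, C (i1 * (D1 (D2 p) - D2 (D1 p)) - i2b * D1 p - (i2a - i1) * D2 p)) ->
  C (i1 * D2 i2b + i1 * D1 i2c - (3 * i2a - i1) * i2c + 3 * i2b ^+ 2) ->
  (forall p q, evK p <> 0 -> C (p * q) -> C q) -> (forall p, C p -> ev p = 0) ->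
  forall r, evK r = 0 <-> C r.
Proof.
move=> dD1 dD2 D1c D2c C0 CD CM CD1 CD2 R1 R2 R3 Cdiv evC r.
rewrite evKE; split=> [/eqP|/evC->]; last exact: tofrac0.
rewrite tofrac_eq0 => /eqP r0.
have L1 := reducible_D1 dD1 dD2 D1c D2c C0 CD CM CD1 CD2 R1 R2 R3.
have L2 := reducible_D2 dD2 D2c C0 CD CM CD2 R1.
apply: (reducible_ev_eq0 (c := c) (D1 := D1) (D2 := D2) (i0 := i0) (i2c := i2c) J
  (ev := ev)) => //.
  by move=> p q p0; apply: Cdiv; rewrite evKE => /eqP; rewrite tofrac_eq0 => /eqP.
elim/F_ind: r {r0} => [a|||p q|p q|p|p].
- exact: reducible_cst.
- exact: (reducible_nsym c D1 D2 i0 i2c C0 (inl (inl tt))).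
- exact: (reducible_nsym c D1 D2 i0 i2c C0 (inr 0)).
- exact: reducibleD.
- exact: reducibleM.
- exact: L1.
exact: L2.
Qed.

Let evKD p q : evK (p + q) = evK p + evK q.
Proof. by rewrite !evKE rmorphD tofracD. Qed.
Let evKM p q : evK (p * q) = evK p * evK q.
Proof. by rewrite !evKE rmorphM tofracM. Qed.
Let evKN p : evK (- p) = - evK p.
Proof. by rewrite !evKE rmorphN tofracN. Qed.
Let evK1 : evK 1 = 1.
Proof. by rewrite !evKE rmorph1 tofrac1. Qed.
Let evKD1 p : evK (D1 p) = N1 (evK p).
Proof. by rewrite !evKE ev_D1 N1_tofrac. Qed.
Let evKD2 p : evK (D2 p) = N2 (evK p).
Proof. by rewrite !evKE ev_D2 N2_tofrac. Qed.
Let evKi2c : evK i2c = I2c.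
Proof. by rewrite evKE ev_i2c I2cE. Qed.

Definition generated (q : K) : Prop :=
  exists a b : F, evK b <> 0 /\ q = evK a / evK b.

Let gen_ev p : generated (evK p).
Proof. by exists p, 1; rewrite evK1 divr1; split=> //; apply/eqP/oner_neq0. Qed.

Let gen_div p q : generated p -> generated q -> generated (p / q).
Proof.
have [->|q0] := eqVneq q 0.
  by move=> _ _; rewrite invr0 mulr0; exists 0, 1; rewrite evK1 evKE rmorph0 tofrac0 mul0r;
    split=> //; apply/eqP/oner_neq0.
move=> [a [b [/eqP b0 ->]]] [a' [b' [/eqP b'0 qE]]].
exists (a * b'), (b * a'); rewrite !evKM qE invf_div mulf_div; split=> //.
apply/eqP; rewrite mulf_neq0 //; apply: contraNneq q0 => a'0.
by rewrite qE a'0 mul0r.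
Qed.

Let gen_inv p : generated p -> generated p^-1.
Proof. by move=> gp; rewrite -[_^-1]div1r -evK1; apply: gen_div. Qed.

Let gen_mul p q : generated p -> generated q -> generated (p * q).
Proof. by move=> gp gq; rewrite -[q]invrK; apply/gen_div/gen_inv. Qed.

Let gen_add p q : generated p -> generated q -> generated (p + q).
Proof.
move=> [a [b [/eqP b0 ->]]] [a' [b' [/eqP b'0 ->]]].
rewrite addf_div // -!evKM -evKD; exact: gen_div.
Qed.

(** The quotient rule keeps the field of rational expressions stable under \nabla_1 and \nabla_2. *)
Let gen_der (N : K -> K) (D : F -> F) : derivation N ->
  (forall p, evK (D p) = N (evK p)) -> forall q, generated q -> generated (N q).
Proof.
move=> dN ND q [a [b [/eqP b0 ->]]]; rewrite (der_div _ dN) // -!ND.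
have gN : generated (- (evK a / evK b * evK (D b))).
  by rewrite -mulNr -mulNr -evKN; apply: gen_mul => //; apply: gen_div.
by apply: gen_div => //; apply: gen_add.
Qed.

Let dN1 : derivation N1 := der_comb X Y dDx dDy.
Let dN2 : derivation N2 := der_combB Ux Uy dDy dDx.

Definition jet_invariant (q : K) : Prop :=
  forall a b c d (f : {rmorphism P -> P}), a * d - b * c = 1 ->
    is_prolongation cst x y u dx dy a b c d f -> frac_map f q = q.

Lemma generated_invariant q : generated q -> jet_invariant q.
Proof.
move=> [m [n [_ ->]]] a b c' d f det1 pf.
have [G GE] := frac_map_rmorphism (prolong_inj J det1 pf); rewrite GE.
have evG p : G (evK p) = evK p.
  elim/F_ind: p => [r|||p p' Ep Eq|p p' Ep Eq|p Ep|p Ep].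
  - have [fc _ _ _] := pf.
    by rewrite evKE ev_cst -GE (frac_map_tofrac (prolong_inj J det1 pf)) fc.
  - by rewrite evKE ev_i0; apply: prolong_u0 det1 pf GE.
  - by rewrite evKi2c; apply: prolong_I2c det1 pf GE.
  - by rewrite evKD rmorphD Ep Eq.
  - by rewrite evKM rmorphM Ep Eq.
  - by rewrite evKD1 (prolong_N1 det1 pf GE) Ep.
  by rewrite evKD2 (prolong_N2 det1 pf GE) Ep.
by rewrite fmorph_div !evG.
Qed.

Lemma presentation_generators q : jet_invariant q <-> generated q.
Proof.
split; last exact: generated_invariant.
elim/frac_ind: q => n d d0 inv.
have genN1 := gen_der dN1 evKD1; have genN2 := gen_der dN2 evKD2.
have gu : generated (u 0%N 0%N)%:F by rewrite -ev_i0 -evKE.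
have g1 : generated I1 by rewrite I1E; apply: genN1.
have gN p : generated p -> generated (- p).
  by move=> gp; rewrite -mulN1r -evK1 -evKN; apply: gen_mul.
have tofrac_inj : injective (@tofrac P) by move=> p q /eqP; rewrite tofrac_eq => /eqP.
apply: (invariant_generated J (iota := @tofrac P) tofrac_inj dDx dDy DxE DyE
  (FF := generated)) => //.
- by move=> r; rewrite /= -ev_cst -evKE.
- by rewrite I2aE; apply: gen_add; [apply/genN1/genN1|apply/gN/genN1].
- by rewrite I2bE; apply/gN/genN2/genN1.
- by rewrite -evKi2c.
move=> a b c' e f det1 pf; apply/eqP; have fI := prolong_inj J det1 pf.
have /eqP := inv _ _ _ _ f det1 pf.
rewrite frac_mapE // eqr_div ?tofrac_eq0 ?(raddf_eq0 _ fI) //.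
by rewrite -!tofracM tofrac_eq.
Qed.

End Presentation.
End JetFunctionField.

(** * Instantiation *)

Lemma mconstN (R : idomainType) (I : choiceType) (a : R) :
  mconst I (- a) = - mconst I a.
Proof. exact: monalgUN. Qed.

Lemma eq_iter2 (T : Type) (F1 F2 G1 G2 : T -> T) i j z :
  F1 =1 G1 -> F2 =1 G2 -> iter i F1 (iter j F2 z) = iter i G1 (iter j G2 z).
Proof. by move=> /funext-> /funext->. Qed.

Lemma addrMN (S : pzRingType) (a b c d : S) : a * b + - c * d = a * b - c * d.
Proof. by rewrite mulNr. Qed.

Lemma addMNr (S : pzRingType) (a b c d : S) : - c * d + a * b = a * b - c * d.
Proof. by rewrite mulNr addrC. Qed.

Lemma rmorph_cancel (A : pzRingType) (S : idomainType) (f : {rmorphism A -> S}) p q :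
  f p != 0 -> f (p * q) = 0 -> f q = 0.
Proof. by rewrite rmorphM => /negPf p0 /eqP; rewrite mulf_eq0 p0 => /eqP. Qed.

Section Instance.
Variable R : realType.
Local Notation J := (jets_jpoly R).
Local Notation cst := (@mconst R jetvar : {rmorphism R -> jpoly R}).
Local Notation "a %:F" := (@tofrac (jpoly R) a).
Local Notation is_prol :=
  (is_prolongation (@mconst R jetvar) (jx R) (jy R) (ju R) (@Dx_poly R) (@Dy_poly R)).

Lemma invmx_det1 (g : 'M[R]_2) : \det g = 1 ->
  [/\ g 0 0 * g 1 1 - g 0 1 * g 1 0 = 1,
      invmx g 0 0 = g 1 1, invmx g 1 0 = - g 1 0,
      invmx g 0 1 = - g 0 1 & invmx g 1 1 = g 0 0].
Proof.
move=> det1; have gU : g \in unitmx by rewrite unitmxE det1 unitr1.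
have det2 : g 0 0 * g 1 1 - g 0 1 * g 1 0 = 1.
  rewrite -det1 (expand_det_row g 0) !big_ord_recl big_ord0 /cofactor !det_mx11 !mxE /=.
  have -> : lift ord0 (0 : 'I_1) = 1 :> 'I_2 by apply/val_inj.
  have -> : lift (1 : 'I_2) (0 : 'I_1) = 0 by apply/val_inj.
  by rewrite /bump /= expr0 expr1; ring.
have E i j : g i 0 * invmx g 0 j + g i 1 * invmx g 1 j = (i == j)%:R.
  have := congr1 (fun M : 'M_2 => M i j) (mulmxV gU); rewrite !mxE => <-.
  rewrite !big_ord_recl big_ord0 addr0.
  by have -> : lift ord0 (0 : 'I_1) = 1 :> 'I_2 by apply/val_inj.
have [[[E00 E01] E10] E11] := (E 0 0, E 0 1, E 1 0, E 1 1).
rewrite /= in E00 E01 E10 E11; split=> //; rewrite -[LHS]mul1r -{1}det2.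
(* Each entry of the inverse is obtained by Cramer's rule from the equations [E]. *)
- rewrite [LHS](_ : _ = g 1 1 * (g 0 0 * invmx g 0 0 + g 0 1 * invmx g 1 0) -
    g 0 1 * (g 1 0 * invmx g 0 0 + g 1 1 * invmx g 1 0)); last by ring.
  by rewrite E00 E10 mulr1 mulr0 subr0.
- rewrite [LHS](_ : _ = g 0 0 * (g 1 0 * invmx g 0 0 + g 1 1 * invmx g 1 0) -
    g 1 0 * (g 0 0 * invmx g 0 0 + g 0 1 * invmx g 1 0)); last by ring.
  by rewrite E00 E10 mulr1 mulr0 sub0r.
- rewrite [LHS](_ : _ = g 1 1 * (g 0 0 * invmx g 0 1 + g 0 1 * invmx g 1 1) -
    g 0 1 * (g 1 0 * invmx g 0 1 + g 1 1 * invmx g 1 1)); last by ring.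
  by rewrite E01 E11 mulr1 mulr0 sub0r.
rewrite [LHS](_ : _ = g 0 0 * (g 1 0 * invmx g 0 1 + g 1 1 * invmx g 1 1) -
  g 1 0 * (g 0 0 * invmx g 0 1 + g 0 1 * invmx g 1 1)); last by ring.
by rewrite E01 E11 mulr1 mulr0 subr0.
Qed.

Lemma prolong_polyP (g : 'M[R]_2) : \det g = 1 ->
  exists f : {rmorphism jpoly R -> jpoly R},
    prolong_poly g = f /\ is_prol (g 0 0) (g 0 1) (g 1 0) (g 1 1) f.
Proof.
move=> /invmx_det1[_ h00 h10 h01 h11].
pose w (v : jetvar) : jpoly R := match v with
    | JX => g 0 0 *: jx R + g 0 1 *: jy R
    | JY => g 1 0 *: jx R + g 1 1 *: jy R
    | JU i j => iter i (fun p => invmx g 0 0 *: Dx_poly p + invmx g 1 0 *: Dy_poly p)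
      (iter j (fun p => invmx g 0 1 *: Dx_poly p + invmx g 1 1 *: Dy_poly p) (ju R 0 0))
    end.
pose f : {rmorphism mpol R jetvar -> mpol R jetvar} := msubst cst w.
have ZE (a : R) (p : jpoly R) : a *: p = mconst jetvar a * p by exact: mpolZE.
exists f; split; first by [].
split.
- exact: (msubst_const cst w).
- apply: etrans (msubst_var cst w JX) _; exact: congr2 (ZE _ _) (ZE _ _).
- apply: etrans (msubst_var cst w JY) _; exact: congr2 (ZE _ _) (ZE _ _).
move=> i j; apply: etrans (msubst_var cst w (JU i j)) _; rewrite /w.
have cN (a : R) : mconst jetvar (- a) = - mconst jetvar a := mconstN jetvar a.
apply: eq_iter2 => p; apply: etrans (congr2 _ (ZE _ _) (ZE _ _)) _.
  rewrite /prolong_dx h00 h10 cN; exact: addrMN.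
rewrite /prolong_dy h01 h11 cN; exact: addMNr.
Qed.

Lemma diff_invariantE (q : jrat R) : diff_invariant q <->
  jet_invariant (@mconst R jetvar) (jx R) (jy R) (ju R) (@Dx_poly R) (@Dy_poly R) q.
Proof.
split=> [inv a b c d f det1 pf|inv g det1].
  pose g : 'M[R]_2 := \matrix_(i, j)
    if i == 0 then (if j == 0 then a else b) else (if j == 0 then c else d).
  have [g00 g01] : g 0 0 = a /\ g 0 1 = b by rewrite !mxE.
  have [g10 g11] : g 1 0 = c /\ g 1 1 = d by rewrite !mxE.
  have detg : \det g = 1.
    rewrite -det1 (expand_det_row g 0) !big_ord_recl big_ord0 /cofactor !det_mx11 !mxE /=.
    by rewrite /bump /= expr0 expr1; ring.
  have [f' [f'E pf']] := prolong_polyP detg; rewrite g00 g01 g10 g11 in pf'.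
  rewrite -[RHS](inv g detg) /prolong f'E.
  by rewrite (prolong_unique J pf pf').
have [f [fE pf]] := prolong_polyP det1.
rewrite /prolong fE; apply: (inv _ _ _ _ _ _ pf).
by have [] := invmx_det1 det1.
Qed.

Lemma prolong_commute (N : jrat R -> jrat R) :
  (forall a b c d (f : {rmorphism jpoly R -> jpoly R})
     (F : {rmorphism jrat R -> jrat R}), a * d - b * c = 1 ->
     is_prol a b c d f -> frac_map f = F -> forall q, F (N q) = N (F q)) ->
  forall g : 'M[R]_2, \det g = 1 -> forall q, N (prolong g q) = prolong g (N q).
Proof.
move=> comm g det1 q; have [f [fE pf]] := prolong_polyP det1.
have [det2 _ _ _ _] := invmx_det1 det1.
have [F FE] := frac_map_rmorphism (prolong_inj J det2 pf).
by rewrite /prolong fE FE (comm _ _ _ _ _ _ det2 pf FE).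
Qed.

Lemma prolong_fixed (q : jrat R) :
  (forall a b c d (f : {rmorphism jpoly R -> jpoly R})
     (F : {rmorphism jrat R -> jrat R}), a * d - b * c = 1 ->
     is_prol a b c d f -> frac_map f = F -> F q = q) -> diff_invariant q.
Proof.
move=> fixed; apply/diff_invariantE => a b c d f det1 pf.
have [F FE] := frac_map_rmorphism (prolong_inj J det1 pf).
by rewrite FE (fixed _ _ _ _ _ _ det1 pf FE).
Qed.

Definition nabla_poly (j : nabla_index) (p : jpoly R) : jpoly R :=
  match j with
  | N1 => jx R * Dx_poly p + jy R * Dy_poly p
  | N2 => ju R 1 0 * Dy_poly p - ju R 0 1 * Dx_poly p
  end.

Definition gen_poly (i : generator) : jpoly R :=
  match i with
  | G0 => ju R 0 0
  | G2c => ju R 1 0 ^+ 2 * ju R 0 2 - 2 * ju R 1 0 * ju R 0 1 * ju R 1 1 +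
           ju R 0 1 ^+ 2 * ju R 2 0
  end.

Lemma nabla_tofrac j p : nabla j p%:F = (nabla_poly j p)%:F.
Proof. by case: j; [exact: (N1_tofrac J)|exact: (N2_tofrac J)]. Qed.

Lemma gen_tofrac i : gen R i = (gen_poly i)%:F.
Proof. by case: i; [by []|exact: (I2cE (ju R))]. Qed.

Lemma nabla_iter_tofrac s i :
  nabla_iter R s i = (foldr nabla_poly (gen_poly i) s)%:F.
Proof.
rewrite /nabla_iter; elim: s => [|j s IHs]; first exact: gen_tofrac.
exact: etrans (congr1 (nabla j) IHs) (nabla_tofrac j _).
Qed.

(** All \nabla_J I_i are polynomials in the jet variables, so [eval] factors through the polynomial
    ring ([eval_polyE]). *)
Definition eval_poly : {rmorphism mpol R (seq nabla_index * generator)%type -> jpoly R} :=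
  msubst cst (fun w => foldr nabla_poly (gen_poly w.2) w.1).

Lemma eval_polyE (r : formal R) : eval r = (eval_poly r)%:F.
Proof.
have E : (fun w : seq nabla_index * generator => nabla_iter R w.1 w.2) =
    (fun w => (foldr nabla_poly (gen_poly w.2) w.1)%:F).
  by apply/funext => w; exact: nabla_iter_tofrac.
rewrite /eval E.
exact: (rmorph_msubst cst (fun w => foldr nabla_poly (gen_poly w.2) w.1)
  (@tofrac (jpoly R)) r).
Qed.

Lemma nabla_poly_derivation j : derivation (nabla_poly j).
Proof.
have dD := (Dx_poly_derivation R, Dy_poly_derivation R).
by case: j; [exact: (der_comb _ _ dD.1 dD.2)|exact: (der_combB _ _ dD.2 dD.1)].
Qed.

Lemma nabla_poly_cst j a : nabla_poly j (mconst jetvar a) = 0.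
Proof.
have E (S : pzRingType) (v w : S) : v * 0 + w * 0 = 0 by rewrite !mulr0 addr0.
have E' (S : pzRingType) (v w : S) : v * 0 - w * 0 = 0 by rewrite !mulr0 subr0.
by case: j; rewrite /nabla_poly Dx_poly_const Dy_poly_const; [exact: E|exact: E'].
Qed.

Lemma eval_poly_nabla j (r : formal R) :
  eval_poly (fnabla j r) = nabla_poly j (eval_poly r).
Proof.
apply: (msubst_mder (nabla_poly_derivation j) (nabla_poly_cst j)) => w.
exact: msubst_var.
Qed.

Lemma formal_ind (Q : formal R -> Prop) :
  (forall a, Q (mconst _ a)) -> Q (fI0 R) -> Q (fI2c R) ->
  (forall p q, Q p -> Q q -> Q (p + q)) -> (forall p q, Q p -> Q q -> Q (p * q)) ->
  (forall p, Q p -> Q (fnabla N1 p)) -> (forall p, Q p -> Q (fnabla N2 p)) ->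
  forall p, Q p.
Proof.
move=> Qc Q0 Q2c QD QM Q1 Q2; apply: (mpol_ind Qc _ QD QM) => -[s i].
elim: s => [|j s IHs]; first by case: i; [exact Q0|exact Q2c].
have <- : fnabla j (mvar R (s, i)) = mvar R (j :: s, i) by exact: mder_var.
by case: j; [exact: Q1|exact: Q2].
Qed.

(** Division in [cons_div] is sound because polynomials on jets form a domain. *)
Lemma consequence_sound (r : formal R) : consequence r -> eval_poly r = 0.
Proof.
have e1 : forall p, eval_poly (fnabla N1 p) = _ := eval_poly_nabla N1.
have e2 : forall p, eval_poly (fnabla N2 p) = _ := eval_poly_nabla N2.
have e0 : eval_poly (fI0 R) = ju R 0 0 by exact: msubst_var.
have e2c : eval_poly (fI2c R) = gen_poly G2c by exact: msubst_var.
elim=> {r}.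
- exact: (ev_R1 J e0 e2).
- move=> p; exact: (ev_R2 J e0 e1 e2 p).
- exact: (ev_R3 J e0 e2c e1 e2).
- exact: rmorph0.
- by move=> p q _ p0 _ q0; rewrite (rmorphD eval_poly) p0 q0 addr0.
- by move=> p q _ q0; rewrite (rmorphM eval_poly) q0 mulr0.
- by move=> j p _ p0; rewrite eval_poly_nabla p0 (der0 (nabla_poly_derivation j)).
move=> p q; rewrite eval_polyE => /eqP; rewrite tofrac_eq0 => p0 _.
exact: rmorph_cancel.
Qed.

End Instance.

Unset Implicit Arguments.

Theorem mainTheorem8 (R : realType) :
  (diff_invariant (@I0 R) /\ diff_invariant (@I2c R)) /\
  (invariant_derivation (@nabla1 R) /\ invariant_derivation (@nabla2 R)) /\
  [/\ @I1 R = nabla1 I0,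
      @I2a R = nabla1 (nabla1 I0) - nabla1 I0 &
      @I2b R = - nabla2 (nabla1 I0)] /\
  (forall q : jrat R,
     I1 * (nabla1 (nabla2 q) - nabla2 (nabla1 q)) - I2b * nabla1 q
       - (I2a - I1) * nabla2 q = 0) /\
  (forall q : jrat R, diff_invariant q <->
     exists a b : formal R, eval b <> 0 /\ q = eval a / eval b) /\
  (forall r : formal R, eval r = 0 <-> consequence r).
Proof.
have J := jets_jpoly R.
have ec a : @eval_poly R (mconst _ a) = mconst jetvar a by exact: msubst_const.
have e1 : forall p, @eval_poly R (fnabla N1 p) = _ := eval_poly_nabla N1.
have e2 : forall p, @eval_poly R (fnabla N2 p) = _ := eval_poly_nabla N2.
have e0 : @eval_poly R (fI0 R) = ju R 0 0 by exact: msubst_var.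
have e2c : @eval_poly R (fI2c R) = gen_poly R G2c by exact: msubst_var.
split; last split; last split; last split; last split.
- split; apply: prolong_fixed => a b c d f F det1 pf FE.
    exact: (prolong_u0 J det1 pf FE).
  exact: (prolong_I2c J det1 pf FE).
- split; split.
  + by exists (tofrac (jx R)), (tofrac (jy R)).
  + by apply: prolong_commute => a b c d f F det1 pf FE; exact: (prolong_N1 J det1 pf FE).
  + exists (- tofrac (ju R 0 1)), (tofrac (ju R 1 0)) => q.
    by rewrite /nabla2 mulNr addrC.
  + by apply: prolong_commute => a b c d f F det1 pf FE; exact: (prolong_N2 J det1 pf FE).
- split; [exact: (I1E J)|exact: (I2aE J)|exact: (I2bE J)].
- exact: (N_commutator J).
- move=> q; apply: iff_trans (diff_invariantE q) _.
  exact: (presentation_generators J (@formal_ind R) ec e0 e2c e1 e2 (@eval_polyE R)).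
exact: (presentation_relations J (@formal_ind R) ec e0 e2c e1 e2 (@eval_polyE R)
  (mder_derivation _) (mder_derivation _) (mder_const _) (mder_const _)
  (cons_0 R) (@cons_add R) (@cons_mul R) (@cons_nabla R N1) (@cons_nabla R N2)
  (cons_R1 R) (@cons_R2 R) (cons_R3 R) (@cons_div R) (@consequence_sound R)).
Qed.
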